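(* Consider the planar piecewise linear system $$\mathbf{x}'=\begin{cases}\mathbf{A}^-\mathbf{x}+\mathbf{b}^-, & x<0,\\ \mathbf{A}^+\mathbf{x}+\mathbf{b}^+, & x>0,\end{cases}\qquad \mathbf{x}=(x,y)^T,$$ where $\mathbf{A}^\pm$ are real constant $2\times 2$ matrices and $\mathbf{b}^\pm\in\mathbb{R}^2$ are constant vectors. Suppose the system is of $NN$ type, i.e. each of the matrices $\mathbf{A}^-$ and $\mathbf{A}^+$ has two distinct nonzero real eigenvalues of the same sign. Then the system has at most two (crossing) limit cycles, counting the multiplicities of limit cycles.
   Context: Orbits reaching the line $x=0$ are continued by the Filippov convention. A crossing periodic orbit is a closed orbit consisting of one solution arc of the left subsystem contained in $\{x<0\}$ except for its two endpoints on $\{x=0\}$, and one solution arc of the right subsystem contained in $\{x>0\}$ except for its endpoints, such that at each of the two points on $\{x=0\}$ the $x$-components of the left and right vector fields are nonzero and have the same sign (so the orbit crosses the line transversally). A (crossing) limit cycle is a crossing periodic orbit that is isolated among crossing periodic orbits. Multiplicity: let $(0,y_0^* )$ be the point where the crossing periodic orbit passes from $\{x>0\}$ into $\{x<0\}$. For $y_0$ near $y_0^*$ let $P_L(y_0)$ be the ordinate of the point at which the forward orbit of the left subsystem starting at $(0,y_0)$ first returns to $\{x=0\}$ after travelling in $\{x<0\}$, and let $P_R^{-1}(y_0)$ be the ordinate of the point at which the backward-in-time orbit of the right subsystem starting at $(0,y_0)$ first returns to $\{x=0\}$ after travelling in $\{x>0\}$. Put $d(y_0)=P_R^{-1}(y_0)-P_L(y_0)$,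 a function analytic near $y_0^*$ with $d(y_0^* )=0$. The multiplicity of the limit cycle is the multiplicity of $y_0^*$ as a zero of $d$. The equilibria of the linear subsystems may be located anywhere in the plane (they need not lie in the half-plane where the subsystem is active). *)

(* Defs.v *)
From HB Require Import structures.
From mathcomp Require Import all_boot all_order all_algebra.
From mathcomp Require Import all_classical all_reals all_analysis.

Set Implicit Arguments.
Unset Strict Implicit.
Unset Printing Implicit Defensive.

Import Order.TTheory GRing.Theory Num.Theory.
Import numFieldNormedType.Exports.

Local Open Scope classical_set_scope.
Local Open Scope ring_scope.

Definition xcoord (R : realType) (p : 'cV[R]_2) : R := p 0 0.

Definition axis_pt (R : realType) (y : R) : 'cV[R]_2 :=
  \col_(i < 2) (if i == 0 then 0 else y).

(* x' = AL x + bL on {x < 0} and x' = AR x + bR on {x > 0}. *)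
Record pwl_system (R : realType) := PWLSystem {
  AL : 'M[R]_2;
  bL : 'cV[R]_2;
  AR : 'M[R]_2;
  bR : 'cV[R]_2
}.

Definition node_type (R : realType) (A : 'M[R]_2) : Prop :=
  exists l1 l2 : R,
    [/\ eigenvalue A l1, eigenvalue A l2, l1 != l2 & 0 < l1 * l2].

Definition NN_type (R : realType) (S : pwl_system R) : Prop :=
  node_type (AL S) /\ node_type (AR S).

Definition affine_field (R : realType) (A : 'M[R]_2) (b p : 'cV[R]_2) :
  'cV[R]_2 := A *m p + b.

(* Solutions of a linear subsystem exist for all times, so a solution arc is
   the restriction to a compact interval of a solution defined on R. *)
Definition is_solution (R : realType) (A : 'M[R]_2) (b : 'cV[R]_2)
    (phi : R -> 'cV[R]_2) : Prop :=
  forall t : R, is_derive t 1 phi (affine_field A b (phi t)).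

(* phi runs from (0, y) at time 0 to (0, z) at time T, and lies in the open
   region H (one of {x < 0}, {x > 0}) at all intermediate times. *)
Definition is_arc (R : realType) (H : set 'cV[R]_2) (A : 'M[R]_2)
    (b : 'cV[R]_2) (y z T : R) (phi : R -> 'cV[R]_2) : Prop :=
  [/\ is_solution A b phi, 0 < T, phi 0 = axis_pt y, phi T = axis_pt z &
      forall t, 0 < t < T -> H (phi t)].

Definition left_plane (R : realType) : set 'cV[R]_2 := [set p | xcoord p < 0].
Definition right_plane (R : realType) : set 'cV[R]_2 := [set p | 0 < xcoord p].

Definition left_arc (R : realType) (S : pwl_system R) :=
  is_arc (@left_plane R) (AL S) (bL S).
Definition right_arc (R : realType) (S : pwl_system R) :=
  is_arc (@right_plane R) (AR S) (bR S).

Definition crossing_at (R : realType) (S : pwl_system R) (y : R) : Prop :=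
  0 < xcoord (affine_field (AL S) (bL S) (axis_pt y)) *
      xcoord (affine_field (AR S) (bR S) (axis_pt y)).

(* Gamma passes from {x > 0} into {x < 0} at (0, y). *)
Definition crossing_orbit_entering_left_at (R : realType) (S : pwl_system R)
    (y : R) (Gamma : set 'cV[R]_2) : Prop :=
  exists (z T1 T2 : R) (phi psi : R -> 'cV[R]_2),
    [/\ left_arc S y z T1 phi,
        right_arc S z y T2 psi,
        crossing_at S y,
        crossing_at S z &
        Gamma = phi @` [set t | 0 <= t <= T1] `|` psi @` [set t | 0 <= t <= T2]].

Definition crossing_periodic_orbit (R : realType) (S : pwl_system R)
    (Gamma : set 'cV[R]_2) : Prop :=
  exists y : R, crossing_orbit_entering_left_at S y Gamma.

Definition limit_cycle (R : realType) (S : pwl_system R)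
    (Gamma : set 'cV[R]_2) : Prop :=
  crossing_periodic_orbit S Gamma /\
  exists U : set 'cV[R]_2,
    [/\ open U, Gamma `<=` U &
        forall Gamma', crossing_periodic_orbit S Gamma' -> Gamma' `<=` U ->
          Gamma' = Gamma].

(* The return ordinates are unique when they exist; where they do not, P_L
   and P_R_inv take the irrelevant value 0. *)
Definition P_L (R : realType) (S : pwl_system R) (y : R) : R :=
  xget 0 [set z | exists (T : R) (phi : R -> 'cV[R]_2), left_arc S y z T phi].

(* The backward right orbit of (0, y) returns at (0, z) iff a forward right
   arc runs from (0, z) to (0, y). *)
Definition P_R_inv (R : realType) (S : pwl_system R) (y : R) : R :=
  xget 0 [set z | exists (T : R) (psi : R -> 'cV[R]_2), right_arc S z y T psi].

Definition displacement (R : realType) (S : pwl_system R) (y : R) : R :=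
  P_R_inv S y - P_L S y.

(* The derivability clause guarantees that the iterated derivatives, which are
   total operators in the library, are genuine. *)
Definition zero_of_multiplicity (R : realType) (f : R -> R) (a : R) (m : nat) :
  Prop :=
  [/\ (0 < m)%N,
      forall k : nat, (k < m)%N -> \forall x \near a, derivable (derive1n k f) x 1,
      forall k : nat, (k < m)%N -> derive1n k f a = 0 &
      derive1n m f a != 0].

Definition has_multiplicity (R : realType) (S : pwl_system R)
    (Gamma : set 'cV[R]_2) (m : nat) : Prop :=
  exists y : R, crossing_orbit_entering_left_at S y Gamma /\
    zero_of_multiplicity (displacement S) y m.

(* Main.v *)
Require Import Defs.
From HB Require Import structures.
From mathcomp Require Import all_boot all_order all_algebra.
From mathcomp Require Import all_classical all_reals all_analysis.
From mathcomp Require Import ring lra.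

Set Implicit Arguments.
Unset Strict Implicit.
Unset Printing Implicit Defensive.

Import Order.TTheory GRing.Theory Num.Theory.
Import numFieldNormedType.Exports.

Local Open Scope classical_set_scope.
Local Open Scope ring_scope.

(* In the coordinates [p_i x + y] diagonalizing a node, an orbit going from
   [(0, y)] to [(0, z)] in time [T] is a solution of the two equations
   [z - c_i = exp (l_i T) (y - c_i)].  The half-returns [(y, z)] of each node
   thus form a curve parametrized by [T], and the crossing periodic orbits are
   the intersections of the curve [(Y, Z)] of the left node with the curve of
   the right node, with rates [j_i] and centres [b_i].  With
   [B_i = ln ((b_i - Y) / (b_i - Z))], an intersection is a point of the left
   curve where [B_1 / B_2 = j_1 / j_2].  The derivative of [B_1 / B_2] vanishes
   exactly where the curve is tangent to a member of the family of curves of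
   all nodes with centres [b_i]; there, the order of contact is 2 and the sign of
   the second difference depends only on the position of [b_1] with respect to
   the corresponding centre of the left node.  So the derivative has at most one zero and, by
   Rolle, there are at most two intersections; a tangency is the only
   intersection and is a double one.  The sign of the second difference reduces
   to an inequality between collinear triples of points of the graph of [sinh].
   If the two nodes have the same centres, then as soon as one orbit is closed
   all are, and none is isolated. *)

(** Write [u = exp (- 2 w)] for minus the slope [dz/dy] of a curve of half-returns. Along the left
    curve the derivative of [B_i] is [B_i * chord u B_i] up to a common positive factor, and
    [chord u x] is, up to a factor depending on [w] alone, the slope of the chord of the graph of
    [sinh] between the abscissas [- w] and [x - w]. So where [B_1 / B_2] is stationary, the pair
    [(B_1, B_2)] and the pair of products of the left rates with the time both cut collinear triples
    through the same point of the graph. Pairs with a common [w] are nested, and the second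
    derivative of the curve is a monotone function of the pair. The comparison of [b_1] with the
    left centre tells which pair is the outer one, hence the sign.

    The half-return map has no closed form: the curves stay parametrized by the time, and the
    displacement function is reached only at the end, by inverting [T -> y]. *)

Section Calculus.
Variable R : realType.
Implicit Types (f g df : R -> R) (a b c d x y : R).

Lemma der_eq f x d d' : is_derive x 1 f d -> d = d' -> is_derive x 1 f d'.
Proof. by move=> H <-. Qed.

Lemma derD f g x a b : is_derive x 1 f a -> is_derive x 1 g b ->
  is_derive x 1 (fun y => f y + g y) (a + b).
Proof. by move=> ? ?; exact: is_deriveD. Qed.

Lemma derN f x a : is_derive x 1 f a -> is_derive x 1 (fun y => - f y) (- a).
Proof. by move=> ?; exact: is_deriveN. Qed.

Lemma derM f g x a b : is_derive x 1 f a -> is_derive x 1 g b ->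
  is_derive x 1 (fun y => f y * g y) (a * g x + f x * b).
Proof.
move=> fa gb; have H := @is_deriveM _ _ f g x 1 a b fa gb.
by apply: (der_eq H); rewrite /GRing.scale /= addrC mulrC.
Qed.

Lemma derV f x a : f x != 0 -> is_derive x 1 f a ->
  is_derive x 1 (fun y => (f y)^-1) (- a / f x ^+ 2).
Proof.
move=> fx0 fa; have H := is_deriveV fx0 fa.
by apply: (der_eq H); rewrite /GRing.scale /= !mulNr mulrC.
Qed.

Lemma derX f x a n : is_derive x 1 f a ->
  is_derive x 1 (fun y => f y ^+ n.+1) (n.+1%:R * f x ^+ n * a).
Proof.
move=> fa; elim: n => [|n IH]; first by apply: (der_eq fa); rewrite expr0 !mul1r.
apply: (der_eq (derM fa IH)); rewrite -(natr1 n.+1) !exprS; ring.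
Qed.

Lemma der_id x : is_derive x 1 (fun y : R => y) 1.
Proof. exact: is_derive_id. Qed.

Lemma der_cst c x : is_derive x 1 (fun _ : R => c) 0.
Proof. exact: is_derive_cst. Qed.

Lemma der_comp f g x a b : is_derive (g x) 1 f a -> is_derive x 1 g b ->
  is_derive x 1 (fun y => f (g y)) (b * a).
Proof.
by move=> fa gb; have H := @is_derive1_comp _ f g x a b fa gb; apply: (der_eq H); rewrite mulrC.
Qed.

Lemma der_exp f x a : is_derive x 1 f a ->
  is_derive x 1 (fun y => expR (f y)) (a * expR (f x)).
Proof. by move=> fa; exact: der_comp (is_derive_expR (f x)) fa. Qed.

Lemma der_ln f x a : 0 < f x -> is_derive x 1 f a ->
  is_derive x 1 (fun y => ln (f y)) (a / f x).
Proof. by move=> fx0 fa; exact: der_comp (is_derive1_ln fx0) fa. Qed.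

Lemma der_continuous f x a : is_derive x 1 f a -> {for x, continuous f}.
Proof.
by move=> [fx _]; apply: differentiable_continuous; exact/derivable1_diffP.
Qed.

Lemma der_within f df a b : (forall x, a <= x <= b -> is_derive x 1 f (df x)) ->
  {within `[a, b], continuous f}.
Proof.
move=> H; apply: continuous_in_subspaceT => x; rewrite inE /= in_itv /= => xab.
exact: der_continuous (H x xab).
Qed.

Lemma mean_value f df a b : a < b ->
  (forall x, a <= x <= b -> is_derive x 1 f (df x)) ->
  exists2 c, a < c < b & f b - f a = df c * (b - a).
Proof.
move=> ab H; have H1 x : x \in `]a, b[ -> is_derive x 1 f (df x).
  by rewrite in_itv /= => /andP[ax xb]; apply: H; rewrite !ltW.
have [c] := MVT ab H1 (der_within H).
by rewrite in_itv /= => cab E; exists c.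
Qed.

Lemma der_nondecreasing f df a b : a <= b ->
  (forall x, a <= x <= b -> is_derive x 1 f (df x)) ->
  (forall x, a < x < b -> 0 <= df x) -> f a <= f b.
Proof.
rewrite le_eqVlt => /orP[/eqP -> //|ab] H P.
have [c cab E] := mean_value ab H.
by rewrite -subr_ge0 E mulr_ge0 ?P // subr_ge0 ltW.
Qed.

Lemma der_increasing f df a b : a < b ->
  (forall x, a <= x <= b -> is_derive x 1 f (df x)) ->
  (forall x, a < x < b -> 0 < df x) -> f a < f b.
Proof.
move=> ab H P; have [c cab E] := mean_value ab H.
by rewrite -subr_gt0 E mulr_gt0 ?P // subr_gt0.
Qed.

Lemma rolle f df a b : a < b ->
  (forall x, a <= x <= b -> is_derive x 1 f (df x)) -> f a = f b ->
  exists2 c, a < c < b & df c = 0.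
Proof.
move=> ab H E; have [c cab] := mean_value ab H; rewrite E subrr => /esym/eqP.
rewrite mulf_eq0 subr_eq0 (gt_eqF ab) orbF => /eqP ?; by exists c.
Qed.

Lemma der_ge0 f df x : (forall y, is_derive y 1 f (df y)) -> f 0 = 0 ->
  (forall y, 0 < y -> 0 <= df y) -> 0 <= x -> 0 <= f x.
Proof.
move=> H f0 P x0; rewrite -f0; apply: (@der_nondecreasing f df) => // y /andP[y0 _].
exact: P.
Qed.

Lemma der_gt0 f df x : (forall y, is_derive y 1 f (df y)) -> f 0 = 0 ->
  (forall y, 0 < y -> 0 < df y) -> 0 < x -> 0 < f x.
Proof.
move=> H f0 P x0; rewrite -f0; apply: (@der_increasing f df) => // y /andP[y0 _].
exact: P.
Qed.

End Calculus.

(** * Hyperbolic functions *)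

HB.lock Definition sinh (R : realType) (x : R) : R := (expR x - expR (- x)) / 2.
HB.lock Definition cosh (R : realType) (x : R) : R := (expR x + expR (- x)) / 2.
Arguments sinh {R} x.
Arguments cosh {R} x.

Section Hyperbolic.
Variable R : realType.
Implicit Types x y : R.

Lemma sinhE x : sinh x = (expR x - expR (- x)) / 2.
Proof. by rewrite sinh.unlock. Qed.

Lemma coshE x : cosh x = (expR x + expR (- x)) / 2.
Proof. by rewrite cosh.unlock. Qed.

Lemma cosh_gt0 x : 0 < cosh x.
Proof. by rewrite coshE divr_gt0 // addr_gt0 // expR_gt0. Qed.

Lemma sinh0 : sinh (0 : R) = 0.
Proof. by rewrite sinhE oppr0 subrr mul0r. Qed.

Lemma cosh0 : cosh (0 : R) = 1.
Proof. by rewrite coshE oppr0 expR0; lra. Qed.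

Lemma sinhN x : sinh (- x) = - sinh x.
Proof. by rewrite !sinhE opprK; ring. Qed.

Lemma coshN x : cosh (- x) = cosh x.
Proof. by rewrite !coshE opprK addrC. Qed.

Lemma cosh_sqr x : cosh x ^+ 2 = 1 + sinh x ^+ 2.
Proof.
have e0 : expR x != 0 by rewrite gt_eqF ?expR_gt0.
by rewrite !coshE !sinhE expRN; field.
Qed.

Lemma sinhD x y : sinh (x + y) = sinh x * cosh y + cosh x * sinh y.
Proof. by rewrite !coshE !sinhE opprD !expRD; field. Qed.

Lemma coshD x y : cosh (x + y) = cosh x * cosh y + sinh x * sinh y.
Proof. by rewrite !coshE !sinhE opprD !expRD; field. Qed.

Lemma sinhB x y : sinh (x - y) = sinh x * cosh y - cosh x * sinh y.
Proof. by rewrite sinhD sinhN coshN mulrN. Qed.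

Lemma coshB x y : cosh (x - y) = cosh x * cosh y - sinh x * sinh y.
Proof. by rewrite coshD sinhN coshN mulrN. Qed.

Lemma der_sinh (f : R -> R) x a : is_derive x 1 f a ->
  is_derive x 1 (fun y => sinh (f y)) (a * cosh (f x)).
Proof.
move=> fa; rewrite sinh.unlock.
apply: (der_eq (derM (derD (der_exp fa) (derN (der_exp (derN fa)))) (der_cst _ x))).
by rewrite coshE; ring.
Qed.

Lemma der_cosh (f : R -> R) x a : is_derive x 1 f a ->
  is_derive x 1 (fun y => cosh (f y)) (a * sinh (f x)).
Proof.
move=> fa; rewrite cosh.unlock.
apply: (der_eq (derM (derD (der_exp fa) (der_exp (derN fa))) (der_cst _ x))).
by rewrite sinhE; ring.
Qed.

Lemma sinh_gt0 x : 0 < x -> 0 < sinh x.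
Proof. by move=> x0; rewrite sinhE divr_gt0 // subr_gt0 ltr_expR; lra. Qed.

Lemma sinh_ge0 x : 0 <= x -> 0 <= sinh x.
Proof. by move=> x0; rewrite sinhE divr_ge0 // subr_ge0 ler_expR; lra. Qed.

Lemma sinh_le0 x : x <= 0 -> sinh x <= 0.
Proof. by move=> x0; rewrite -[x]opprK sinhN oppr_le0 sinh_ge0 // oppr_ge0. Qed.

Lemma cosh_gt1 x : 0 < x -> 1 < cosh x.
Proof.
move=> x0; have := cosh_sqr x; have := sinh_gt0 x0; have := cosh_gt0 x; nra.
Qed.

End Hyperbolic.

(** [der] builds a derivative from the syntax of the function, taking those of abstract functions
    from the context. It leaves the side conditions of inverses and logarithms, and the equality of
    the value found with the expected one. *)
Ltac der_step :=
  lazymatch goal with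
  | |- is_derive _ _ (fun _ => ?c) _ => exact: der_cst
  | |- is_derive _ _ (fun y => y) _ => exact: der_id
  | |- is_derive _ _ (fun y => @?f y + @?g y) _ => eapply (@derD _ f g)
  | |- is_derive _ _ (fun y => - @?f y) _ => eapply (@derN _ f)
  | |- is_derive _ _ (fun y => (@?f y)^-1) _ => eapply (@derV _ f)
  | |- is_derive _ _ (fun y => (@?f y) ^+ ?n) _ => eapply (@derX _ f)
  | |- is_derive _ _ (fun y => expR (@?f y)) _ => eapply (@der_exp _ f)
  | |- is_derive _ _ (fun y => ln (@?f y)) _ => eapply (@der_ln _ f)
  | |- is_derive _ _ (fun y => sinh (@?f y)) _ => eapply (@der_sinh _ f)
  | |- is_derive _ _ (fun y => cosh (@?f y)) _ => eapply (@der_cosh _ f)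
  | |- is_derive _ _ (fun y => @?f y * @?g y) _ =>
      eapply (@derM _ f g)
  end.
Ltac der := eapply der_eq;
  [ repeat first [ eassumption | der_step ] | ].

(** * Hyperbolic inequalities *)

Section HyperbolicInequalities.
Variable R : realType.
Implicit Types x y d s p m w t : R.

Lemma ltr_sinh x y : x < y -> sinh x < sinh y.
Proof.
move=> xy; apply: (@der_increasing _ _ cosh) => // [z _|z _]; last exact: cosh_gt0.
by apply: (der_eq (der_sinh (der_id z))); ring.
Qed.

Lemma sinh_gt_id x : 0 < x -> x < sinh x.
Proof.
move=> x0; rewrite -subr_gt0.
apply: (@der_gt0 _ (fun x => sinh x - x) (fun x => cosh x - 1)) => // [y||y y0].
- by der; ring.
- by rewrite sinh0 subrr.
- by rewrite subr_gt0 cosh_gt1.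
Qed.

Lemma sinh_lt_mul_cosh x : 0 < x -> sinh x < x * cosh x.
Proof.
move=> x0; rewrite -subr_gt0.
apply: (@der_gt0 _ (fun x => x * cosh x - sinh x) (fun x => x * sinh x)) => // [y||y y0].
- by der; ring.
- by rewrite sinh0; ring.
- by rewrite mulr_gt0 ?sinh_gt0.
Qed.

Lemma id_lt_sinh_cosh x : 0 < x -> x < sinh x * cosh x.
Proof.
move=> x0; have := sinh_gt_id x0; have := cosh_gt1 x0; nra.
Qed.

(** Two differentiations lead to [x cosh x - sinh x]. The difference of the two sides is the
    numerator of the derivative of [- langevin x / x]. *)
Lemma sinh_sqr_le x : 0 <= x ->
  2 * sinh x ^+ 2 <= x ^+ 2 + x * sinh x * cosh x.
Proof.
move=> x0; rewrite -subr_ge0; move: x0.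
apply: (@der_ge0 _ (fun x => x ^+ 2 + x * sinh x * cosh x - 2 * sinh x ^+ 2)
   (fun x => 3 * x + 2 * x * sinh x ^+ 2 - 3 * sinh x * cosh x)) => // [y||y y0].
- by der; ring: (cosh_sqr y).
- by rewrite sinh0 cosh0; ring.
apply: (@der_ge0 _ (fun x => 3 * x + 2 * x * sinh x ^+ 2 - 3 * sinh x * cosh x)
   (fun x => 4 * sinh x * (x * cosh x - sinh x))) => // [z||z z0|]; last exact: ltW.
- by der; ring: (cosh_sqr z).
- by rewrite sinh0 cosh0; ring.
- by rewrite mulr_ge0 ?subr_ge0 ?ltW ?sinh_lt_mul_cosh // mulr_gt0 // sinh_gt0.
Qed.

(* Lazarevic's inequality; after division by [cosh x] three derivatives are
   sums of nonnegative terms in [cosh x ^+ 2 - 1]. *)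
Lemma sinh_cube_ge x : 0 <= x -> x ^+ 3 * cosh x <= sinh x ^+ 3.
Proof.
move=> x0; have c0 := cosh_gt0 x; rewrite -ler_pdivlMr // -subr_ge0; move: x0 {c0}.
have cN0 y : cosh y != 0 by rewrite gt_eqF ?cosh_gt0.
apply: (@der_ge0 _ (fun x => sinh x ^+ 3 / cosh x - x ^+ 3)
   (fun x => 2 * sinh x ^+ 2 + (1 - (cosh x ^+ 2)^-1) - 3 * x ^+ 2)) => // [y||y y0].
- der; first exact: cN0.
  have c2 := cosh_sqr y; set c := cosh y in c2 *; set s := sinh y in c2 *.
  have c0 : c != 0 := cN0 y.
  by field: c2.
- by rewrite sinh0 cosh0; field.
pose g x := 2 * sinh x ^+ 2 + (1 - (cosh x ^+ 2)^-1) - 3 * x ^+ 2 : R.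
pose dg x := 4 * sinh x * cosh x + 2 * sinh x / cosh x ^+ 3 - 6 * x : R.
pose ddg x := (cosh x ^+ 2 - 1) ^+ 2 * (8 * cosh x ^+ 2 + 6) / cosh x ^+ 4 : R.
have dgP (z : R) : is_derive z 1 dg (ddg z).
  rewrite /dg; der; first by rewrite expf_neq0.
  have c2 := cosh_sqr z; rewrite /ddg; set c := cosh z in c2 *; set s := sinh z in c2 *.
  have c0 : c != 0 := cN0 z.
  by field: c2.
have gP (z : R) : is_derive z 1 g (dg z).
  rewrite /g; der; first by rewrite expf_neq0.
  have c0 : cosh z != 0 := cN0 z.
  by rewrite /dg; field.
apply: (der_ge0 gP) => [||]; last exact: ltW.
  by rewrite /g sinh0 cosh0; field.
move=> z z0; apply: (der_ge0 dgP) => [||]; last exact: ltW.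
  by rewrite /dg sinh0; field.
move=> w _; rewrite /ddg divr_ge0 // ?exprn_even_ge0 // mulr_ge0 ?sqr_ge0 //.
by rewrite addr_ge0 // mulr_ge0 // sqr_ge0.
Qed.

Lemma sinh_div_lt x y : 0 < x -> x < y -> sinh x / x < sinh y / y.
Proof.
move=> x0 xy.
apply: (@der_increasing _ (fun z => sinh z / z)
  (fun z => (z * cosh z - sinh z) / z ^+ 2)) => // z /andP[xz _].
- have z0 : z != 0 by rewrite gt_eqF // (lt_le_trans x0).
  by der; field.
- have z0 := lt_trans x0 xz.
  by rewrite divr_gt0 ?exprn_gt0 // subr_gt0 sinh_lt_mul_cosh.
Qed.

Lemma mul_coth_lt x y : 0 < x -> x < y ->
  x * cosh x / sinh x < y * cosh y / sinh y.
Proof.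
move=> x0 xy.
apply: (@der_increasing _ (fun z => z * cosh z / sinh z)
  (fun z => (sinh z * cosh z - z) / sinh z ^+ 2)) => // z /andP[xz _].
- have z0 : sinh z != 0 by rewrite gt_eqF ?sinh_gt0 // (lt_le_trans x0).
  by der; field: (cosh_sqr z).
- have z0 := lt_trans x0 xz.
  by rewrite divr_gt0 ?exprn_gt0 ?sinh_gt0 // subr_gt0 id_lt_sinh_cosh.
Qed.

(** The logarithmic derivative of [sinh x / x]. *)
Definition langevin x : R := cosh x / sinh x - x^-1.

Lemma langevin_gt0 x : 0 < x -> 0 < langevin x.
Proof.
move=> x0; have s0 := sinh_gt0 x0; rewrite subr_gt0 -[x^-1]mul1r.
by rewrite ltr_pdivrMr // mulrAC ltr_pdivlMr // mul1r mulrC sinh_lt_mul_cosh.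
Qed.

Lemma langevin_div_le x y : 0 < x -> x <= y -> langevin y / y <= langevin x / x.
Proof.
move=> x0 xy; rewrite -lerN2.
apply: (@der_nondecreasing _ (fun z => - (langevin z / z))
  (fun z => (z ^+ 2 + z * sinh z * cosh z - 2 * sinh z ^+ 2)
              / (z ^+ 3 * sinh z ^+ 2))) => // z /andP[xz _].
- have z0 : z != 0 by rewrite gt_eqF // (lt_le_trans x0).
  have s0 : sinh z != 0 by rewrite gt_eqF ?sinh_gt0 // (lt_le_trans x0).
  by rewrite /langevin; der; field: (cosh_sqr z); rewrite z0 s0.
- have z0 := lt_trans x0 xz.
  rewrite divr_ge0 ?subr_ge0 ?sinh_sqr_le 1?ltW //.
  by rewrite mulr_gt0 ?exprn_gt0 ?sinh_gt0.
Qed.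

(* Equivalent to the concavity of the Langevin function, by its Riccati
   equation [L' = 1 - L^2 - 2 L / x]. *)
Lemma langevin_riccati_le x y : 0 < x -> x <= y ->
  langevin x ^+ 2 + 2 * langevin x / x <= langevin y ^+ 2 + 2 * langevin y / y.
Proof.
move=> x0 xy.
apply: (@der_nondecreasing _ (fun z => langevin z ^+ 2 + 2 * langevin z / z)
  (fun z => 2 * (sinh z ^+ 3 - z ^+ 3 * cosh z)
              / (z ^+ 3 * sinh z ^+ 3))) => // z /andP[xz _].
- have z0 : z != 0 by rewrite gt_eqF // (lt_le_trans x0).
  have s0 : sinh z != 0 by rewrite gt_eqF ?sinh_gt0 // (lt_le_trans x0).
  by rewrite /langevin; der; field: (cosh_sqr z); rewrite z0 s0.
- have z0 := lt_trans x0 xz.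
  rewrite divr_ge0 //; first by rewrite mulr_ge0 // subr_ge0 sinh_cube_ge ?ltW.
  by rewrite mulr_ge0 // exprn_ge0 // ltW ?sinh_gt0.
Qed.

Lemma cosh_sub_gt0 x y : 0 <= x -> x < y -> 0 < cosh y - cosh x.
Proof.
move=> x0 xy; have y0 := le_lt_trans x0 xy.
have := cosh_sqr x; have := cosh_sqr y; have := cosh_gt0 x; have := cosh_gt0 y.
have := ltr_sinh xy; have := sinh_ge0 x0; nra.
Qed.

(** With [p = tanh p1], the equation says that the points of abscissas [p1 - s], [p1 - d], [p1 + d]
    on the graph of [sinh] are collinear. The bound [langevin s] is the limit of [p] as [d] tends to
    [s]. *)
Lemma langevin_le_slope d s p : 0 < d -> d < s ->
  p * (cosh s - cosh d) = sinh s - s * (sinh d / d) -> langevin s <= p.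
Proof.
move=> d0 ds E; have s0 := lt_trans d0 ds; have S0 := sinh_gt0 s0.
have D0 := cosh_sub_gt0 (ltW d0) ds.
(* [f d] is the difference of the two sides, cleared of denominators. For fixed [s], [f] vanishes at
   [s] and is nonincreasing before it because [langevin x / x] is. *)
pose f x := sinh s * cosh s - s + cosh x * (s * cosh s - sinh s)
            - s ^+ 2 * sinh s * (sinh x / x).
suff F : 0 <= f d.
  rewrite -(ler_pM2r D0) E -(ler_pM2r (mulr_gt0 s0 S0)) -subr_ge0.
  suff -> : (sinh s - s * (sinh d / d)) * (s * sinh s) -
     langevin s * (cosh s - cosh d) * (s * sinh s) = f d by [].
  have dN := lt0r_neq0 d0; have sN := lt0r_neq0 s0; have SN := lt0r_neq0 S0.
  by rewrite /f /langevin; field: (cosh_sqr s); rewrite dN sN SN.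
rewrite -[0](_ : f s = 0); last first.
  have sN := lt0r_neq0 s0.
  by rewrite /f; field: (cosh_sqr s); rewrite sN.
rewrite -lerN2.
apply: (@der_nondecreasing _ (fun x => - f x)
  (fun x => s ^+ 2 * sinh s * sinh x * (langevin x / x - langevin s / s)))
  => [|z /andP[xz _]|z /andP[xz zs]]; first exact: ltW.
- have z0 := lt_le_trans d0 xz; have zN := lt0r_neq0 z0.
  have sN := lt0r_neq0 s0; have SN := lt0r_neq0 S0.
  have ZN := lt0r_neq0 (sinh_gt0 z0).
  by rewrite /f /langevin; der; field; rewrite zN sN SN ZN.
- have z0 := lt_trans d0 xz.
  rewrite mulr_ge0 //; last by rewrite subr_ge0 langevin_div_le // ltW.
  apply: ltW; rewrite !mulr_gt0 ?exprn_gt0 ?sinh_gt0 //.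
Qed.

(** With [b = langevin d], division by [sinh d ^+ 2] leaves a polynomial in [p], [b], [d^-1]. If
    [s b <= d p], all its terms are nonnegative. Otherwise it is the sum of [(p - b) (s b - d p)]
    and of [s] times an increment that [langevin_riccati_le] controls, since [langevin s <= p]. *)
Lemma slope_quadratic_gt0 d s p : 0 < d -> d < s ->
  p * (cosh s - cosh d) = sinh s - s * (sinh d / d) ->
  cosh d - sinh d / d < p * sinh d ->
  0 < 2 * cosh d * (d * (p * sinh d) - s * (cosh d - sinh d / d))
      + (s - d) * (p * sinh d) * (p * sinh d + (cosh d - sinh d / d)).
Proof.
move=> d0 ds E G; have s0 := lt_trans d0 ds; have D0 := sinh_gt0 d0.
have dN := lt0r_neq0 d0; have sN := lt0r_neq0 s0; have DN := lt0r_neq0 D0.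
have := langevin_le_slope d0 ds E; have := langevin_riccati_le d0 (ltW ds).
have := langevin_gt0 s0; have := langevin_gt0 d0.
set a := langevin s; set b := langevin d => b0 a0 R1 ap.
have gE : cosh d - sinh d / d = b * sinh d by rewrite /b /langevin; field; rewrite dN.
have CE : cosh d = (b + d^-1) * sinh d by rewrite /b /langevin; field; rewrite dN.
rewrite gE ltr_pM2r // in G *; rewrite CE.
have -> : 2 * ((b + d^-1) * sinh d) * (d * (p * sinh d) - s * (b * sinh d))
   + (s - d) * (p * sinh d) * (p * sinh d + b * sinh d)
  = sinh d ^+ 2 * (2 * (b + d^-1) * (d * p - s * b) + (s - d) * p * (p + b)) by ring.
rewrite mulr_gt0 ?exprn_gt0 //.
have p0 := lt_le_trans a0 ap.
have {R1} R1 : b ^+ 2 + 2 * b / d <= p ^+ 2 + 2 * p / s.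
  apply: (le_trans R1); rewrite lerD ?ler_pM2r ?invr_gt0 ?ler_pM2l //.
  by rewrite lerXn2r // nnegrE ltW.
have P1 : 0 < (s - d) * p * (p + b) by apply: mulr_gt0; [apply: mulr_gt0; rewrite ?subr_gt0|apply: addr_gt0].
have [spd|spd] := leP (s * b) (d * p).
  by rewrite ltr_wpDl // !mulr_ge0 ?subr_ge0 // ltW // addr_gt0 ?invr_gt0.
have {}R1 : 0 <= s * (p ^+ 2 + 2 * p / s - (b ^+ 2 + 2 * b / d)).
  by rewrite mulr_ge0 ?subr_ge0 // ltW.
have -> : 2 * (b + d^-1) * (d * p - s * b) + (s - d) * p * (p + b) =
  s * (p ^+ 2 + 2 * p / s - (b ^+ 2 + 2 * b / d)) + (p - b) * (s * b - d * p).
  by field; rewrite dN.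
by rewrite ltr_wpDl // mulr_gt0 // subr_gt0.
Qed.

End HyperbolicInequalities.

(** * Collinear triples on the graphs of [tanh] and [sinh] *)

Section Chord.
Variable R : realType.
Implicit Types x y w t m p l : R.

Definition tanh x : R := sinh x / cosh x.

Lemma tanhN x : tanh (- x) = - tanh x.
Proof. by rewrite /tanh sinhN coshN mulNr. Qed.

Lemma tanhB x y : tanh x - tanh y = sinh (x - y) / (cosh x * cosh y).
Proof.
have cx := lt0r_neq0 (cosh_gt0 x); have cy := lt0r_neq0 (cosh_gt0 y).
by rewrite /tanh sinhB; field; rewrite cx cy.
Qed.

Lemma tanh_mul_lt x y : 0 < x -> x < y -> tanh y * x < tanh x * y.
Proof.
move=> x0 xy; have y0 := lt_trans x0 xy.
have := mul_coth_lt x0 xy; rewrite ltr_pdivrMr ?sinh_gt0 // [ltRHS]mulrAC ltr_pdivlMr ?sinh_gt0 // => H.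
rewrite /tanh mulrAC [ltRHS]mulrAC ltr_pdivrMr ?cosh_gt0 // [ltRHS]mulrAC ltr_pdivlMr ?cosh_gt0 //.
by move: H; rewrite -subr_gt0 => H; rewrite -subr_gt0 (_ : _ - _ = y * cosh y * sinh x - x * cosh x * sinh y) //; ring.
Qed.

(* The intercept of the line is computed from two of its chords. *)
Lemma tanh_collinear_le0 p1 p2 p3 l : p3 < p2 -> p2 < p1 ->
  tanh p1 - tanh p3 = l * (p1 - p3) -> tanh p1 - tanh p2 = l * (p1 - p2) ->
  0 < p1 -> p3 < 0 -> p2 * (p1 + p3) <= 0.
Proof.
move=> p32 p21 E3 E2 p1_gt0 p3_lt0.
have {}E3 : tanh p3 = tanh p1 - l * (p1 - p3) by rewrite -E3; ring.
have {}E2 : tanh p2 = tanh p1 - l * (p1 - p2) by rewrite -E2; ring.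
pose n := tanh p1 - l * p1.
have q0 : 0 < - p3 by rewrite oppr_gt0.
have N13 : n * (p1 - p3) = tanh p1 * - p3 - tanh (- p3) * p1.
  by rewrite tanhN /n; ring: E3.
have N12 : n * (p1 - p2) = tanh p2 * p1 - tanh p1 * p2.
  by rewrite /n; ring: E2.
have N23 : n * (p2 - p3) = - (tanh (- p2) * - p3 - tanh (- p3) * - p2).
  by rewrite !tanhN /n; ring: E2 E3.
rewrite leNgt; apply/negP => P.
have [p2_le0|p2_gt0] := leP p2 0.
  have p2_lt0 : p2 < 0 by nra.
  have H1 := @tanh_mul_lt (- p2) (- p3); have H2 := @tanh_mul_lt p1 (- p3).
  have {}H1 := H1 ltac:(lra) ltac:(lra).
  have {}H2 := H2 ltac:(lra) ltac:(nra).
  nra.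
have H1 := @tanh_mul_lt p2 p1 p2_gt0 p21.
have H2 := @tanh_mul_lt (- p3) p1 q0 ltac:(nra).
nra.
Qed.

(** [m] is a weighted mean of the slopes from the origin to the points of abscissas [w] and
    [t2 - w]. If [w <= t2 - w], it is at most the second one, which is smaller than the slope from
    the origin to [t1 - w]; the third point then lies above the line. *)
Lemma sinh_chord_lt w t1 t2 m : 0 < w -> 0 < t2 -> t2 < t1 ->
  m * t1 = sinh (t1 - w) + sinh w -> m * t2 = sinh (t2 - w) + sinh w ->
  t2 < 2 * w.
Proof.
move=> w0 t20 t21 E1 E2; rewrite ltNge; apply/negP => wt.
have X2 : 0 < t2 - w by lra.
have H1 := @sinh_div_lt _ (t2 - w) (t1 - w) X2 ltac:(lra).
have H2 : sinh w / w <= sinh (t2 - w) / (t2 - w).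
  have [E|wX] := eqVneq w (t2 - w); first by rewrite -E.
  by apply/ltW/sinh_div_lt => //; rewrite lt_neqAle wX; lra.
have e1 : sinh (t1 - w) = sinh (t1 - w) / (t1 - w) * (t1 - w).
  by rewrite divfK // gt_eqF; lra.
have e2 : sinh (t2 - w) = sinh (t2 - w) / (t2 - w) * (t2 - w).
  by rewrite divfK // gt_eqF.
have e3 : sinh w = sinh w / w * w by rewrite divfK // gt_eqF.
move: H1 H2 e1 e2 e3.
set q1 := sinh (t1 - w) / _; set q2 := sinh (t2 - w) / _; set q := sinh w / _.
move=> H1 H2 e1 e2 e3; rewrite e1 e3 in E1; rewrite e2 e3 in E2.
have mq : m <= q2.
  have : 0 <= (q2 - q) * w by rewrite mulr_ge0 ?subr_ge0 // ltW.
  by move=> H; rewrite -(ler_pM2r t20) E2; lra.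
have : (q1 - q2) * (t1 - w) <= 0.
  have -> : (q1 - q2) * (t1 - w) = (m - q2) * (t1 - t2).
    by rewrite [RHS]mulrBl [m * _]mulrBr E1 E2; ring.
  by rewrite mulr_le0_ge0 ?subr_le0 ?subr_ge0 // ltW.
by rewrite leNgt mulr_gt0 ?subr_gt0 //; lra.
Qed.

Lemma sinh_sum x y : sinh (x - y) + sinh y = 2 * sinh (x / 2) * cosh (x / 2 - y).
Proof.
have -> : x - y = x / 2 + (x / 2 - y) by field.
have {2}-> : y = x / 2 - (x / 2 - y) by field.
by rewrite sinhD (sinhB (x / 2) (x / 2 - y)); ring.
Qed.

(* The points of abscissas [- w], [t2 - w], [t1 - w] on the graph of [sinh] are
   collinear, on a line of slope [m].  The claim says that the sum of the four
   values of [sinh] at these abscissas and at their sum increases with [m]. *)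
Lemma sinh_chord_core w t1 t2 m : 0 < w -> 0 < t2 -> t2 < t1 ->
  m * t1 = sinh (t1 - w) + sinh w -> m * t2 = sinh (t2 - w) + sinh w ->
  cosh (t2 - w) < m -> m < cosh (t1 - w) ->
  t2 * (cosh (t1 - w) - m) * (cosh (t2 - w) + cosh (t1 + t2 - 3 * w)) <
  t1 * (m - cosh (t2 - w)) * (cosh (t1 - w) + cosh (t1 + t2 - 3 * w)).
Proof.
move=> w0 t20 t21 E1 E2 bm ma.
have t2w := sinh_chord_lt w0 t20 t21 E1 E2.
(* The three abscissas become [p1 - s], [p1 - d], [p1 + d]; collinearity then determines [tanh p1]
   from [d] and [s]. *)
pose s := (t1 + t2) / 2; pose d := (t1 - t2) / 2; pose p1 := s - w.
have t1E : t1 = s + d by rewrite /s /d; field.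
have t2E : t2 = s - d by rewrite /s /d; field.
have d0 : 0 < d by rewrite /d; lra.
have ds : d < s by rewrite /d /s; lra.
have X1E : t1 - w = p1 + d by rewrite t1E /p1; ring.
have X2E : t2 - w = p1 - d by rewrite t2E /p1; ring.
have wE : w = s - p1 by rewrite /p1; ring.
have dN := lt0r_neq0 d0; have e0 := cosh_gt0 p1; have eN := lt0r_neq0 e0.
have two0 : 2 != 0 :> R by rewrite pnatr_eq0.
have md : m * d = cosh p1 * sinh d.
  apply: (mulfI two0).
  transitivity (m * t1 - m * t2); first by rewrite t1E t2E; ring.
  by rewrite E1 E2 X1E X2E (sinhD p1 d) (sinhB p1 d); ring.
have ms : m * s = sinh p1 * cosh d + (sinh s * cosh p1 - cosh s * sinh p1).
  apply: (mulfI two0).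
  transitivity (m * t1 + m * t2); first by rewrite t1E t2E; ring.
  by rewrite E1 E2 X1E X2E (sinhD p1 d) (sinhB p1 d) wE (sinhB s p1); ring.
have mE : m = cosh p1 * (sinh d / d) by rewrite mulrA -md mulfK.
pose p := tanh p1; have pE : sinh p1 = p * cosh p1 by rewrite /p /tanh divfK.
have pEq : p * (cosh s - cosh d) = sinh s - s * (sinh d / d).
  apply: (mulIf eN); have -> : (sinh s - s * (sinh d / d)) * cosh p1 =
    sinh s * cosh p1 - m * s by rewrite mE; ring.
  by rewrite ms pE; ring.
have aE : cosh (t1 - w) = cosh p1 * (cosh d + p * sinh d).
  by rewrite X1E (coshD p1 d) pE; ring.
have bE : cosh (t2 - w) = cosh p1 * (cosh d - p * sinh d).
  by rewrite X2E (coshB p1 d) pE; ring.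
have G : cosh d - sinh d / d < p * sinh d.
  by move: bm; rewrite mE bE ltr_pM2l // => bm; lra.
have H := slope_quadratic_gt0 d0 ds pEq G.
have p_gt0 : 0 < p.
  rewrite -(pmulr_lgt0 _ (cosh_sub_gt0 (ltW d0) ds)) pEq subr_gt0.
  have := sinh_div_lt d0 ds; rewrite ltr_pdivlMr ?(lt_trans d0) // => /le_lt_trans; apply.
  by rewrite mulrC.
have p1_gt0 : 0 < p1.
  rewrite ltNge; apply/negP => p1_le0.
  have : 0 < sinh p1 by rewrite pE mulr_gt0.
  by rewrite ltNge sinh_le0.
have ba : cosh (t2 - w) < cosh (t1 - w) by apply: lt_trans bm ma.
set c := cosh (t1 + t2 - 3 * w).
have c0 : 0 < c := cosh_gt0 _.
(* The half-sums [p1], [p2], [p3] of pairs of the three abscissas are the abscissas of collinear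
   points on the graph of [tanh]. The inequality becomes [sinh (p1 + p3) * sinh p2 <= 0]. *)
have cb : c <= cosh (t2 - w).
  pose p2 := t1 / 2 - w; pose p3 := t2 / 2 - w.
  pose l := m / (2 * (cosh p1 * cosh p2 * cosh p3)).
  have e2 := cosh_gt0 p2; have e3 := cosh_gt0 p3.
  have e2N := lt0r_neq0 e2; have e3N := lt0r_neq0 e3.
  have T13 : tanh p1 - tanh p3 = 2 * l * (p1 - p3).
    have -> : 2 * l * (p1 - p3) = m * t1 / (2 * (cosh p1 * cosh p2 * cosh p3)).
      by rewrite /l /p1 /p3 /s; field; rewrite eN e2N e3N.
    have d13 : p1 - p3 = t1 / 2 by rewrite /p1 /p3 /s; field.
    by rewrite tanhB d13 E1 sinh_sum; field; rewrite eN e2N e3N.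
  have T12 : tanh p1 - tanh p2 = 2 * l * (p1 - p2).
    have -> : 2 * l * (p1 - p2) = m * t2 / (2 * (cosh p1 * cosh p2 * cosh p3)).
      by rewrite /l /p1 /p2 /s; field; rewrite eN e2N e3N.
    have d12 : p1 - p2 = t2 / 2 by rewrite /p1 /p2 /s; field.
    by rewrite tanhB d12 E2 sinh_sum; field; rewrite eN e2N e3N.
  have p32 : p3 < p2 by rewrite /p2 /p3; lra.
  have p21 : p2 < p1 by rewrite /p2 /p1 /s; lra.
  have p3_lt0 : p3 < 0 by rewrite /p3; lra.
  have P := tanh_collinear_le0 p32 p21 T13 T12 p1_gt0 p3_lt0.
  have S1 : t2 - w = (p1 + p3) - p2 by rewrite /p1 /p2 /p3 /s; field.
  have S2 : t1 + t2 - 3 * w = (p1 + p3) + p2 by rewrite /p1 /p2 /p3 /s; field.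
  rewrite /c S1 S2 (coshD (p1 + p3) p2) (coshB (p1 + p3) p2) -subr_ge0.
  have -> : forall u v : R, u - v - (u + v) = - (2 * v) by move=> u v; ring.
  rewrite oppr_ge0 pmulr_rle0 //.
  have [p2_le0|p2_gt0] := leP p2 0.
    have [->|p2N] := eqVneq p2 0; first by rewrite sinh0 mulr0.
    have p2_lt0 : p2 < 0 by rewrite lt_neqAle p2N.
    rewrite mulr_ge0_le0 //; first by rewrite sinh_ge0 //; nra.
    by rewrite sinh_le0.
  rewrite mulr_le0_ge0 //; last by rewrite sinh_ge0 // ltW.
  by rewrite sinh_le0 //; nra.
(* This is the claim with [c] replaced by [b = cosh (t2 - w)]. The passage to [c <= b] rests on [2 b
   (a + c) - (a + b) (b + c) = (a - b) (b - c)], where [a = cosh (t1 - w)]. *)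
have F : 2 * cosh (t2 - w) * (t2 * (cosh (t1 - w) - m)) <
         (cosh (t1 - w) + cosh (t2 - w)) * (t1 * (m - cosh (t2 - w))).
  rewrite t1E in aE X1E *; rewrite t2E in bE X2E *; rewrite aE bE mE -subr_gt0.
  move: H; set y := p * sinh d; set q := sinh d / d => H.
  have -> : (cosh p1 * (cosh d + y) + cosh p1 * (cosh d - y)) *
     ((s + d) * (cosh p1 * q - cosh p1 * (cosh d - y))) -
     2 * (cosh p1 * (cosh d - y)) *
      ((s - d) * (cosh p1 * (cosh d + y) - cosh p1 * q)) =
     2 * cosh p1 ^+ 2 * (2 * cosh d * (d * y - s * (cosh d - q)) +
       (s - d) * y * (y + (cosh d - q))) by ring.
  by rewrite mulr_gt0 // mulr_gt0 // exprn_gt0.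
have b0 := cosh_gt0 (t2 - w).
move: F bm ma ba cb b0; rewrite -/c.
set a := cosh (t1 - w); set b := cosh (t2 - w) => F bm ma ba cb b0.
have bc0 : 0 < b + c by rewrite addr_gt0.
have F1 : (b + c) * (2 * b * (t2 * (a - m))) < (b + c) * ((a + b) * (t1 * (m - b))).
  by rewrite ltr_pM2l.
have t10 : 0 < t1 by lra.
have F2 : 0 <= (a - b) * (b - c) * (t1 * (m - b)).
  by rewrite !mulr_ge0 ?subr_ge0 // ltW.
rewrite -(ltr_pM2l (_ : 0 < 2 * b)) ?mulr_gt0 // -subr_gt0.
have := ltr_leD F1 F2; rewrite addr0 -subr_gt0 => F3.
by rewrite (_ : _ - _ = (b + c) * ((a + b) * (t1 * (m - b))) + (a - b) * (b - c) * (t1 * (m - b)) - (b + c) * (2 * b * (t2 * (a - m)))) //; ring.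
Qed.

End Chord.

(** * Inverse functions on an open set *)

Section LocalInverse.
Variable R : realType.
Implicit Types (g dg : R -> R) (z v : R).

(** A total function, with value 0 off the image. It serves both for the partner of a point in a
    pair and for the time of a half-return. *)
Definition inverse_on (D : set R) g v : R := xget 0 [set z | D z /\ g z = v].

Lemma inverse_onP (D : set R) g v : (exists2 z, D z & g z = v) ->
  D (inverse_on D g v) /\ g (inverse_on D g v) = v.
Proof.
by move=> [z Dz gz]; have := @xgetPex _ 0 [set z | D z /\ g z = v]; apply; exists z.
Qed.

Lemma inverse_onK (D : set R) g :
  (forall z z', D z -> D z' -> g z = g z' -> z = z') ->
  forall z, D z -> inverse_on D g (g z) = z.
Proof.
move=> ginj z Dz; have [//|Di gi] := @inverse_onP D g (g z); first by exists z.
exact: ginj.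
Qed.

Lemma local_inverse (D : set R) g dg z0 : open D -> D z0 ->
  (forall z, D z -> is_derive z 1 g (dg z)) ->
  (forall z z', D z -> D z' -> g z = g z' -> z = z') -> dg z0 != 0 ->
  is_derive (g z0) 1 (inverse_on D g) (dg z0)^-1 /\
  \forall v \near g z0, D (inverse_on D g v) /\ g (inverse_on D g v) = v.
Proof.
move=> oD Dz0 dgP ginj dgN.
have nD : \forall z \near z0, D z by apply: open_nbhs_nbhs.
have K : {near z0, cancel g (inverse_on D g)}.
  by near=> z; apply: inverse_onK => //; near: z.
have C : {near z0, continuous g}.
  by near=> z; apply: (@der_continuous _ _ _ (dg z)); apply: dgP; near: z.
split; first by apply: (is_derive_inverse K C) => //; exact: dgP.
have [Ci Ki] := near_can_continuousAcan_sym K C.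
have Ci0 : {for g z0, continuous (inverse_on D g)} := nbhs_singleton Ci.
near=> v; split; last by near: v.
near: v; apply: Ci0; rewrite inverse_onK //.
Unshelve. all: by end_near. Qed.

End LocalInverse.

(** * Pairs of points on a line through a fixed point of the graph of sinh *)

Section Pairs.
Variable R : realType.
Implicit Types x y w t s m u z : R.

(** The slope of the chord of the graph of [sinh] between the abscissas [- w] and [t - w];
    [chi_num w t] is [t ^+ 2] times its derivative. *)
Definition chi w t : R := (sinh (t - w) + sinh w) / t.
Definition chi_num w t : R := t * cosh (t - w) - (sinh (t - w) + sinh w).

Lemma der_chi w t : t != 0 -> is_derive t 1 (chi w) (chi_num w t / t ^+ 2).
Proof. by move=> t0; rewrite /chi /chi_num; der; field. Qed.

Lemma der_chi_num w t : is_derive t 1 (chi_num w) (t * sinh (t - w)).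
Proof. by rewrite /chi_num; der; ring. Qed.

Lemma chi_num0 w : chi_num w 0 = 0.
Proof. by rewrite /chi_num sub0r sinhN; ring. Qed.

(** If [w <= 0], [sinh] is convex to the right of [- w], so the slopes of the chords from that point
    increase. *)
Lemma chi_pair_gt0 w t1 t2 : 0 < t2 -> t2 < t1 -> chi w t1 = chi w t2 -> 0 < w.
Proof.
move=> t20 t21 E; rewrite ltNge; apply/negP => w0.
have : chi w t2 < chi w t1; last by rewrite E ltxx.
apply: (@der_increasing _ _ (fun t => chi_num w t / t ^+ 2)) => // t /andP[t2t _].
  by apply: der_chi; rewrite gt_eqF // (lt_le_trans t20).
have t0 := lt_trans t20 t2t; rewrite divr_gt0 ?exprn_gt0 //.
apply: (der_gt0 (der_chi_num w)) => //; first exact: chi_num0.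
by move=> y y0; rewrite mulr_gt0 ?sinh_gt0 //; lra.
Qed.

(** [chi_num w] starts from 0, decreases up to [w] and increases afterwards, so the zero given by
    Rolle is its only positive one. *)
Lemma chi_pair_sign w t1 t2 : 0 < t2 -> t2 < t1 -> chi w t1 = chi w t2 ->
  exists x, [/\ t2 < x < t1, forall t, 0 < t < x -> chi_num w t < 0 &
                forall t, x < t -> 0 < chi_num w t].
Proof.
move=> t20 t21 E; have w0 := chi_pair_gt0 t20 t21 E.
have [x /andP[t2x xt1]] := @rolle _ (chi w) (fun t => chi_num w t / t ^+ 2) _ _ t21
  (fun t h => der_chi w (lt0r_neq0 (lt_le_trans t20 (proj1 (andP h))))) (esym E).
have x0 := lt_trans t20 t2x.
move=> /eqP; rewrite mulf_eq0 invr_eq0 expf_eq0 /= (gt_eqF x0) orbF => /eqP Nx.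
have N_lt0 t : 0 < t <= w -> chi_num w t < 0.
  move=> /andP[t0 tw]; rewrite -(chi_num0 w) -ltrN2.
  apply: (@der_increasing _ (fun t => - chi_num w t) (fun t => - (t * sinh (t - w)))) => //.
    by move=> y _; apply: derN; exact: der_chi_num.
  move=> y /andP[y0 yt]; rewrite -mulrN mulr_gt0 // -sinhN sinh_gt0 //; lra.
have wx : w < x by rewrite ltNge; apply/negP => xw; move: (N_lt0 x); rewrite x0 xw Nx ltxx => /(_ isT).
have mono y t : w <= y -> y < t -> chi_num w y < chi_num w t.
  move=> wy yt; apply: (@der_increasing _ _ (fun t => t * sinh (t - w))) => //.
    by move=> z _; exact: der_chi_num.
  by move=> z /andP[yz _]; rewrite mulr_gt0 ?sinh_gt0 //; lra.
exists x; split; first by rewrite t2x.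
- move=> t /andP[t0 tx]; have [tw|wt] := leP t w; first by rewrite N_lt0 // t0.
  by rewrite -Nx mono // ltW.
- by move=> t xt; rewrite -Nx mono // ltW.
Qed.

(** The sum of the values of [sinh] at the abscissas of a collinear triple and at their sum, without
    the term at [- w], which is common to all pairs. *)
Definition sinh_sum3 w x y : R := sinh (x + y - 3 * w) + sinh (x - w) + sinh (y - w).

Lemma chi_decreasing w x y z : (forall t, 0 < t < x -> chi_num w t < 0) ->
  0 < y -> y < z -> z <= x -> chi w z < chi w y.
Proof.
move=> N y0 yz zx; rewrite -ltrN2.
apply: (@der_increasing _ (fun t => - chi w t) (fun t => - (chi_num w t / t ^+ 2)))
  => // t /andP[yt tz].
  by apply: derN; apply: der_chi; rewrite gt_eqF // (lt_le_trans y0).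
have t0 := lt_trans y0 yt.
by rewrite -mulNr divr_gt0 ?exprn_gt0 // oppr_gt0 N // t0 (lt_le_trans tz).
Qed.

Lemma chi_increasing w x y z : (forall t, x < t -> 0 < chi_num w t) -> 0 < x ->
  x <= y -> y < z -> chi w y < chi w z.
Proof.
move=> N x0 xy yz.
apply: (@der_increasing _ (chi w) (fun t => chi_num w t / t ^+ 2)) => // t /andP[yt _].
  by apply: der_chi; rewrite gt_eqF // (lt_le_trans x0) // (le_trans xy).
have xt := le_lt_trans xy yt.
by rewrite divr_gt0 ?exprn_gt0 ?N // (lt_trans x0).
Qed.

Lemma chi_pair_unique w t1 t2 s1 :
  0 < t2 -> t2 < t1 -> chi w t1 = chi w t2 -> t2 < s1 -> chi w s1 = chi w t2 ->
  s1 = t1.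
Proof.
move=> t20 t21 tE ts sE.
have [x [/andP[t2x xt1] Nneg Npos]] := chi_pair_sign t20 t21 tE.
have x0 := lt_trans t20 t2x.
have xs1 : x < s1.
  rewrite ltNge; apply/negP => s1x.
  by have := chi_decreasing Nneg t20 ts s1x; rewrite sE ltxx.
apply/eqP; rewrite eq_le; apply/andP; split; rewrite leNgt; apply/negP => H.
- by have := chi_increasing Npos x0 (ltW xt1) H; rewrite sE tE ltxx.
- by have := chi_increasing Npos x0 (ltW xs1) H; rewrite sE tE ltxx.
Qed.

Lemma chi_pair_nested w t1 t2 s1 s2 :
  0 < t2 -> t2 < t1 -> chi w t1 = chi w t2 ->
  0 < s2 -> s2 < s1 -> chi w s1 = chi w s2 -> s2 < t2 ->
  t1 < s1 /\ sinh_sum3 w t1 t2 < sinh_sum3 w s1 s2.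
Proof.
move=> t20 t21 tE s20 s21 sE st.
have w0 := chi_pair_gt0 t20 t21 tE.
have [x [/andP[t2x xt1] Nneg Npos]] := chi_pair_sign t20 t21 tE.
have x0 := lt_trans t20 t2x.
have xs1 : x < s1.
  rewrite ltNge; apply/negP => s1x.
  by have := chi_decreasing Nneg s20 s21 s1x; rewrite sE ltxx.
have ts : t1 < s1.
  rewrite ltNge le_eqVlt; apply/negP => /orP[/eqP E|H].
    by have := chi_decreasing Nneg s20 st (ltW t2x); rewrite -tE -sE E ltxx.
  have := chi_increasing Npos x0 (ltW xs1) H.
  by rewrite sE tE ltNge ltW // (chi_decreasing Nneg s20 st (ltW t2x)).
split=> //.
pose D := [set z : R | x < z].
have oD : open D by exact: open_gt.
have dD z : D z -> is_derive z 1 (chi w) (chi_num w z / z ^+ 2).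
  by move=> /= xz; apply: der_chi; rewrite gt_eqF // (lt_trans x0).
have inj z z' : D z -> D z' -> chi w z = chi w z' -> z = z'.
  rewrite /D /= => xz xz' E; apply/eqP; rewrite eq_le.
  apply/andP; split; rewrite leNgt; apply/negP => H.
  - by have := chi_increasing Npos x0 (ltW xz') H; rewrite E ltxx.
  - by have := chi_increasing Npos x0 (ltW xz) H; rewrite E ltxx.
(* The partner of [y] on the increasing branch of [chi w]; it moves [t1] to [s1] as [y] goes from
   [t2] to [s2]. *)
pose h y := inverse_on D (chi w) (chi w y).
have hP y : s2 <= y <= t2 -> D (h y) /\ chi w (h y) = chi w y.
  move=> /andP[sy yt]; apply: inverse_onP.
  have cw : {within `[t1, s1], continuous (chi w)}.
    apply: (@der_within _ _ (fun z => chi_num w z / z ^+ 2)) => z /andP[tz _].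
    by apply: der_chi; rewrite gt_eqF // (lt_le_trans (lt_trans t20 t21)).
  have [|z] := @IVT _ (chi w) t1 s1 (chi w y) (ltW ts) cw.
    rewrite sE tE ge_min le_max; apply/andP; split; apply/orP.
    - left; move: yt; rewrite le_eqVlt => /orP[/eqP -> //|yt].
      by rewrite ltW // (chi_decreasing Nneg (lt_le_trans s20 sy) yt (ltW t2x)).
    - right; move: sy; rewrite le_eqVlt => /orP[/eqP -> //|sy].
      by rewrite ltW // (chi_decreasing Nneg s20 sy) // (le_trans yt) // ltW.
  by rewrite in_itv /= => /andP[tz _] E; exists z => //; exact: lt_le_trans tz.
have hs : h s2 = s1 by rewrite /h -sE inverse_onK.
have ht : h t2 = t1 by rewrite /h -tE inverse_onK.
rewrite -hs -ht -ltrN2.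
(* Implicit differentiation of [chi w (h y) = chi w y]. With it, [sinh_chord_core] says exactly that
   [sinh_sum3 w (h y) y] decreases in [y]. *)
pose dh y := chi_num w y / y ^+ 2 * (chi_num w (h y) / h y ^+ 2)^-1.
have dhP y : s2 <= y <= t2 -> is_derive y 1 h (dh y).
  move=> yI; have [Dh hE] := hP y yI; have /andP[sy yt] := yI.
  have hN : chi_num w (h y) / h y ^+ 2 != 0.
    have h0 := lt_trans x0 Dh.
    by rewrite gt_eqF // divr_gt0 ?exprn_gt0 // Npos.
  have [+ _] := local_inverse oD Dh dD inj hN; rewrite hE => hinv.
  by apply: der_comp hinv _; apply: der_chi; rewrite gt_eqF // (lt_le_trans s20).
apply: (@der_increasing _ (fun y => - sinh_sum3 w (h y) y)
  (fun y => - (cosh (h y + y - 3 * w) * (dh y + 1) + cosh (h y - w) * dh y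
               + cosh (y - w)))) => // y yI.
  by have Dy := dhP y yI; rewrite /sinh_sum3; der; ring.
have {yI} yI : s2 <= y <= t2 by case/andP: yI => *; rewrite !ltW.
have [Dh hE] := hP y yI; have /andP[sy yt] := yI.
have y0 := lt_le_trans s20 sy; have h0 := lt_trans x0 Dh.
have yx := le_lt_trans yt t2x; have yh := lt_trans yx Dh.
have e1 : chi w (h y) * h y = sinh (h y - w) + sinh w by rewrite divfK // gt_eqF.
have e2 : chi w (h y) * y = sinh (y - w) + sinh w by rewrite hE divfK // gt_eqF.
have n1 : chi_num w (h y) = h y * (cosh (h y - w) - chi w (h y)).
  by rewrite /chi_num -e1; ring.
have n2 : chi_num w y = y * (cosh (y - w) - chi w (h y)).
  by rewrite /chi_num -e2; ring.
have m1 : chi w (h y) < cosh (h y - w).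
  by have := Npos _ Dh; rewrite n1 pmulr_rgt0 // subr_gt0.
have m2 : cosh (y - w) < chi w (h y).
  by have := Nneg y; rewrite y0 yx n2 pmulr_rlt0 // subr_lt0; apply.
have := sinh_chord_core w0 y0 yh e1 e2 m2 m1.
rewrite /dh n1 n2; move: m1 m2 h0 y0.
set a := cosh (h y - w); set b := cosh (y - w); set c := cosh (h y + y - 3 * w).
set m := chi w (h y); set t := h y => m1 m2 t0 y0 C.
have am : a - m != 0 by rewrite gt_eqF // subr_gt0.
rewrite -[X in _ < X](_ : (t * (m - b) * (a + c) - y * (a - m) * (b + c))
   / (y * (a - m)) = _); last first.
  by field; rewrite am !gt_eqF.
by rewrite divr_gt0 ?subr_gt0 // mulr_gt0 // subr_gt0.
Qed.

End Pairs.

(** * Chord pairs in exponential form and their contact *)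

Section Chords.
Variable R : realType.
Implicit Types x y w t s m u z : R.

Definition eslope x : R := (expR x - 1) / x.
(** Chosen so that [x * chord u x = u (exp x - 1) + (1 - exp (- x))], which is how [log_ratio]
    varies along a curve with [- dz/dy = u]. *)
Definition chord u x : R := u * eslope x + eslope (- x).
(* At the point of time [T] of a curve of half-returns with rates [k_i], if
   [u = - dz/dy] and [x_i = k_i T], this is [(y - z) d2z/dy2]. *)
Definition contact u x1 x2 : R :=
  chord u x1 * ((u * expR x1 + expR (- x1)) - (u * expR x2 + expR (- x2)))
    / (eslope x1 - eslope x2).

(** The symmetry [(u, x) -> (1/u, - x)] transfers the results on positive pairs to negative ones. *)
Lemma chordN u x : u != 0 -> chord u^-1 (- x) = u^-1 * chord u x.
Proof. by move=> u0; rewrite /chord opprK; field. Qed.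

Lemma eslopeD_chord u x y : chord u x = chord u y ->
  eslope (- x) - eslope (- y) = - u * (eslope x - eslope y).
Proof. by rewrite /chord => E; rewrite mulNr mulrBr; lra. Qed.

Lemma contactN u x1 x2 : u != 0 -> chord u x1 = chord u x2 ->
  contact u^-1 (- x1) (- x2) = - u^-1 ^+ 3 * contact u x1 x2.
Proof.
move=> u0 E; rewrite /contact chordN // (eslopeD_chord E) !opprK.
rewrite invfM invrN.
set d := (eslope x1 - eslope x2)^-1.
by field.
Qed.

(** Taking out the factor [exp (- w)] symmetrizes the exponentials: two points with equal [chord u]
    form a collinear triple with [- w]. *)
Lemma chord_chi w x : x != 0 -> chord (expR (- (2 * w))) x = 2 * expR (- w) * chi w x.
Proof.
move=> x0; rewrite /chord /eslope /chi !sinhE.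
have -> : - (2 * w) = - w - w by ring.
rewrite opprB !expRD !expRN.
have ex := lt0r_neq0 (expR_gt0 x); have ew := lt0r_neq0 (expR_gt0 w).
by field; rewrite x0 ex ew.
Qed.

Lemma chi_gt0 w x : 0 < w -> 0 < x -> 0 < chi w x.
Proof.
move=> w0 x0; rewrite divr_gt0 // -[sinh w]opprK -sinhN subr_gt0 ltr_sinh //; lra.
Qed.

(** [eslope x] is [exp w * chi w x * (1 + tanh (x / 2 - w))], so on a pair the denominator of
    [contact] is a difference of [tanh]. The quotient is then a product [4 sinh cosh cosh], which
    expands into four values of [sinh]. *)
Lemma contact_sinh w x1 x2 : 0 < x2 -> x2 < x1 -> chi w x1 = chi w x2 ->
  contact (expR (- (2 * w))) x1 x2 =
  2 * expR (- w) ^+ 3 * (sinh_sum3 w x1 x2 + sinh w).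
Proof.
move=> x20 x21 E; have w0 := chi_pair_gt0 x20 x21 E.
have x10 := lt_trans x20 x21.
pose p1 := x1 / 2 - w; pose p2 := x2 / 2 - w; pose d := (x1 - x2) / 2.
have d0 : 0 < d by rewrite /d; lra.
have x1N := lt0r_neq0 x10; have x2N := lt0r_neq0 x20.
have c1N := lt0r_neq0 (cosh_gt0 p1); have c2N := lt0r_neq0 (cosh_gt0 p2).
have sN := lt0r_neq0 (sinh_gt0 d0); have mN := lt0r_neq0 (chi_gt0 w0 x10).
have ewN := lt0r_neq0 (expR_gt0 (- w)).
have slopeE x : x != 0 -> eslope x = (expR (- w))^-1 * (chi w x * (1 + tanh (x / 2 - w))).
  move=> x0; pose y := x / 2; pose p := y - w.
  have cN : cosh (y - w) != 0 := lt0r_neq0 (cosh_gt0 _).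
  have xE : x = y + y by rewrite /y; field.
  rewrite /chi sinh_sum -/y /tanh /eslope xE.
  transitivity (2 * sinh y * (cosh (y - w) + sinh (y - w)) / expR (- w) / (y + y)).
    rewrite !sinhE coshE opprB !expRD !expRN.
    have ey := lt0r_neq0 (expR_gt0 y); have ew := lt0r_neq0 (expR_gt0 w).
    by field; rewrite -xE x0 ey ew.
  by field; rewrite -xE x0 ewN cN.
have T : tanh p1 - tanh p2 = sinh d / (cosh p1 * cosh p2).
  by rewrite tanhB (_ : p1 - p2 = d) // /p1 /p2 /d; field.
have D : eslope x1 - eslope x2 =
    (expR (- w))^-1 * chi w x1 * sinh d / (cosh p1 * cosh p2).
  by rewrite !slopeE // -E -/p1 -/p2 -mulrA -T; ring.
have e2 : expR (- (2 * w)) = expR (- w) ^+ 2 by rewrite expr2 -expRD; congr expR; ring.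
have V x : expR (- (2 * w)) * expR x + expR (- x) = 2 * expR (- w) * cosh (x - w).
  rewrite e2 coshE opprB !expRD !expRN.
  have ex := lt0r_neq0 (expR_gt0 x); have ew := lt0r_neq0 (expR_gt0 w).
  by field; rewrite ex ew.
rewrite /contact chord_chi // !V D.
have a1 : x1 - w = (p1 + p2 + w) + d by rewrite /p1 /p2 /d; field.
have a2 : x2 - w = (p1 + p2 + w) - d by rewrite /p1 /p2 /d; field.
have -> : 2 * expR (- w) * chi w x1 *
   (2 * expR (- w) * cosh (x1 - w) - 2 * expR (- w) * cosh (x2 - w)) /
   ((expR (- w))^-1 * chi w x1 * sinh d / (cosh p1 * cosh p2)) =
   2 * expR (- w) ^+ 3 * (4 * sinh (p1 + p2 + w) * (cosh p1 * cosh p2)).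
  rewrite a1 a2 (coshD (p1 + p2 + w)) (coshB (p1 + p2 + w)).
  by field; rewrite ewN mN sN c1N c2N.
congr (_ * _); rewrite /sinh_sum3.
have -> : x1 + x2 - 3 * w = p1 + p1 + p2 + p2 + w by rewrite /p1 /p2; field.
have -> : x1 - w = p1 + p1 + w by rewrite /p1; field.
have -> : x2 - w = p2 + p2 + w by rewrite /p2; field.
rewrite !sinhE !coshE !opprD !expRD !expRN.
by field; rewrite !(gt_eqF (expR_gt0 _)).
Qed.

Lemma expR_half_ln u : 0 < u -> expR (- (2 * (- (ln u / 2)))) = u.
Proof. by move=> u0; rewrite -[RHS]lnK ?posrE //; congr expR; field. Qed.

Lemma chord_eq_chi u x y : 0 < u -> x != 0 -> y != 0 -> chord u x = chord u y ->
  chi (- (ln u / 2)) x = chi (- (ln u / 2)) y.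
Proof.
move=> u0 x0 y0; rewrite -{1 2}(expR_half_ln u0) !chord_chi //.
by apply: mulfI; rewrite mulf_neq0 // gt_eqF ?expR_gt0.
Qed.

(** Together with [chord_pair_gt1], this forbids a tangency between curves whose rates have opposite
    signs. *)
Lemma chord_pair_lt1 u x1 x2 : 0 < u -> 0 < x2 -> x2 < x1 ->
  chord u x1 = chord u x2 -> u < 1.
Proof.
move=> u0 x20 x21 E; have x10 := lt_trans x20 x21.
have := chi_pair_gt0 x20 x21 (chord_eq_chi u0 (lt0r_neq0 x10) (lt0r_neq0 x20) E).
rewrite oppr_gt0 pmulr_llt0 ?invr_gt0 // => lu.
by rewrite ltNge; apply/negP => /ln_ge0; rewrite leNgt lu.
Qed.

Lemma contact_lt u x1 x2 z1 z2 : 0 < u ->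
  0 < x2 -> x2 < x1 -> chord u x1 = chord u x2 ->
  0 < z2 -> z2 < z1 -> chord u z1 = chord u z2 ->
  x1 < z1 -> contact u x1 x2 < contact u z1 z2.
Proof.
move=> u0 x20 x21 Ex z20 z21 Ez xz.
have {Ex}Ex := chord_eq_chi u0 (lt0r_neq0 (lt_trans x20 x21)) (lt0r_neq0 x20) Ex.
have {Ez}Ez := chord_eq_chi u0 (lt0r_neq0 (lt_trans z20 z21)) (lt0r_neq0 z20) Ez.
rewrite -(expR_half_ln u0); move: Ex Ez; set w := - (ln u / 2) => Ex Ez.
rewrite !contact_sinh // ltr_pM2l ?ltrD2r; last by rewrite mulr_gt0 // exprn_gt0 ?expR_gt0.
have [xz2|zx2|E] := ltgtP x2 z2.
- have [zx1 _] := chi_pair_nested z20 z21 Ez x20 x21 Ex xz2.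
  by rewrite ltNge (ltW xz) in zx1.
- exact: (chi_pair_nested x20 x21 Ex z20 z21 Ez zx2).2.
- have /eqP := chi_pair_unique x20 x21 Ex (lt_trans x21 xz) (etrans Ez (congr1 _ (esym E))).
  by rewrite gt_eqF.
Qed.

Lemma chord_pair_unique u x1 x2 z2 : 0 < u ->
  0 < x2 -> x2 < x1 -> chord u x1 = chord u x2 ->
  0 < z2 -> z2 < x1 -> chord u x1 = chord u z2 -> x2 = z2.
Proof.
move=> u0 x20 x21 Ex z20 zx Ez.
have x1N := lt0r_neq0 (lt_trans x20 x21).
have {Ex}Ex := chord_eq_chi u0 x1N (lt0r_neq0 x20) Ex.
have {Ez}Ez := chord_eq_chi u0 x1N (lt0r_neq0 z20) Ez.
have [xz|zx2|//] := ltgtP x2 z2.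
- have [] := chi_pair_nested z20 zx Ez x20 x21 Ex xz; by rewrite ltxx.
- have [] := chi_pair_nested x20 x21 Ex z20 zx Ez zx2; by rewrite ltxx.
Qed.

Section Reflect.
Variable u : R.
Hypothesis u0 : 0 < u.
Let uN : u != 0 := lt0r_neq0 u0.
Let chordE x y : chord u x = chord u y -> chord u^-1 (- x) = chord u^-1 (- y).
Proof. by rewrite !chordN // => ->. Qed.

Lemma chord_pair_gt1 x1 x2 : x1 < x2 -> x2 < 0 -> chord u x1 = chord u x2 -> 1 < u.
Proof.
move=> x12 x20 /chordE E; have := @chord_pair_lt1 u^-1 (- x1) (- x2).
rewrite invr_gt0 oppr_gt0 ltrN2 invf_lt1 // => H; exact: H.
Qed.

Lemma contact_gt x1 x2 z1 z2 :
  x1 < x2 -> x2 < 0 -> chord u x1 = chord u x2 ->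
  z1 < z2 -> z2 < 0 -> chord u z1 = chord u z2 ->
  z1 < x1 -> contact u z1 z2 < contact u x1 x2.
Proof.
move=> x12 x20 Ex z12 z20 Ez zx.
have := @contact_lt u^-1 (- x1) (- x2) (- z1) (- z2).
rewrite invr_gt0 !oppr_gt0 !ltrN2 !contactN // !mulNr ltrN2 ltr_pM2l ?exprn_gt0 ?invr_gt0 //.
by move=> H; apply: H => //; exact: chordE.
Qed.

Lemma chord_pair_uniqueN x1 x2 z2 :
  x1 < x2 -> x2 < 0 -> chord u x1 = chord u x2 ->
  x1 < z2 -> z2 < 0 -> chord u x1 = chord u z2 -> x2 = z2.
Proof.
move=> x12 x20 Ex z12 z20 Ez; apply: oppr_inj.
have := @chord_pair_unique u^-1 (- x1) (- x2) (- z2).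
rewrite invr_gt0 !oppr_gt0 !ltrN2; move=> H; apply: H => //; exact: chordE.
Qed.

End Reflect.

Lemma eslope_gt0 x : x != 0 -> 0 < eslope x.
Proof.
rewrite neq_lt => /orP[x0|x0]; rewrite /eslope.
  by rewrite -mulrNN -invrN divr_gt0 ?oppr_gt0 // subr_lt0 expR_lt1.
by rewrite divr_gt0 // subr_gt0 expR_gt1.
Qed.

Lemma der_eslope (f : R -> R) x a : f x != 0 -> is_derive x 1 f a ->
  is_derive x 1 (fun y => eslope (f y)) (a * ((expR (f x) - eslope (f x)) / f x)).
Proof. by move=> x0 fa; rewrite /eslope; der; field. Qed.

Lemma eslope_der_gt0 x : x != 0 -> 0 < (expR x - eslope x) / x.
Proof.
move=> x0.
have -> : (expR x - eslope x) / x = (1 - (1 - x) * expR x) / x ^+ 2.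
  by rewrite /eslope; field.
rewrite divr_gt0 ?exprn_even_gt0 // subr_gt0.
have := expR_gt1Dx (_ : - x != 0); rewrite oppr_eq0 => /(_ x0) H.
by rewrite -(ltr_pM2r (expR_gt0 (- x))) mul1r -mulrA -expRD subrr expR0 mulr1.
Qed.

Lemma eslope_lt x y : x < y -> 0 < x \/ y < 0 -> eslope x < eslope y.
Proof.
move=> xy xy0.
have N z : x <= z <= y -> z != 0.
  by move=> /andP[xz zy]; rewrite neq_lt; case: xy0 => h; apply/orP; [right|left]; lra.
apply: (@der_increasing _ eslope (fun z => 1 * ((expR z - eslope z) / z))) => // z.
  move=> /N zN; exact: (der_eslope zN (der_id z)).
by move=> /andP[xz zy]; rewrite mul1r eslope_der_gt0 // N // !ltW.
Qed.

End Chords.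

(** * Functions that cross zero only upwards *)

Section SignChange.
Variable R : realType.
Implicit Types (f df : R -> R) (a b c x : R).

Lemma der_pos_sign f c d : is_derive c 1 f d -> 0 < d -> f c = 0 ->
  \forall x \near c, (x < c -> f x < 0) /\ (c < x -> 0 < f x).
Proof.
move=> /is_derive1_caratheodory [g [fE gc gd]] d0 fc0.
have gpos : \forall x \near c, 0 < g x.
  have := gc; rewrite /continuous_at => /cvgr_gt; apply; by rewrite gd.
near=> x; have gx : 0 < g x by near: x.
have := fE x; rewrite fc0 subr0 => ->; split=> xc.
- by rewrite pmulr_rlt0 // subr_lt0.
- by rewrite pmulr_rgt0 // subr_gt0.
Unshelve. all: by end_near. Qed.

(** Let [c] be the infimum of the points of []a, b]] where [f <= 0]; it is beyond [a], since [f] is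
    positive just after [a]. If [f c <= 0], then [f] is negative just before [c]; if [0 < f c], it
    is positive just after [c]. Both contradict the choice of [c]. *)
Lemma upcrossing_unique f df a b : a < b ->
  (forall x, a <= x <= b -> is_derive x 1 f (df x)) ->
  (forall x, a <= x <= b -> f x = 0 -> 0 < df x) -> f a = 0 -> f b = 0 -> False.
Proof.
move=> ab fd pos fa fb.
have sgn c : a <= c <= b ->
    exists2 e, 0 < e & (f c <= 0 -> forall x, c - e < x < c -> f x < 0) /\
      (0 < f c -> forall x, c <= x < c + e -> 0 < f x).
  move=> cab; have cc := der_continuous (fd c cab).
  suff : \forall x \near c, (f c <= 0 -> x < c -> f x < 0) /\ (0 < f c -> 0 < f x).
    move=> /nbhs_ballP[e /= e0 H]; exists e => //; split=> fc x xI.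
    - case/andP: xI => x1 x2; apply: (H x _).1 => //.
      by rewrite /ball /= ger0_norm ?subr_ge0 ?ltW //; lra.
    - case/andP: xI => x1 x2; apply: (H x _).2 => //.
      by rewrite /ball /= ler0_norm ?subr_le0 //; lra.
  have [fc|fc|fc] := ltgtP (f c) 0.
  - have /cvgr_lt/(_ 0 fc) := cc; apply: filterS => x ? ; split=> //.
  - have /cvgr_gt/(_ 0 fc) := cc; apply: filterS => x ? ; split=> // h.
  - have := der_pos_sign (fd c cab) (pos c cab fc) fc.
    by apply: filterS => x [h _]; split.
have [e e0 He] : exists2 e, 0 < e & forall x, a < x < a + e -> 0 < f x.
  have aab : a <= a <= b by rewrite lexx ltW.
  have /nbhs_ballP[e /= e0 H] := der_pos_sign (fd a aab) (pos a aab fa) fa.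
  exists e => // x /andP[ax xe]; apply: (H x _).2 => //.
  by rewrite /ball /= ler0_norm ?subr_le0 ?ltW //; lra.
pose S := [set x : R | a < x <= b /\ f x <= 0].
have Sb : S b by rewrite /S /= ab lexx fb lexx.
have Slow : lbound S (a + e).
  move=> x [/andP[ax xb] fx]; rewrite leNgt; apply/negP => xe.
  by move: fx; rewrite leNgt He // ax.
have hS : has_inf S by split; [exists b | exists (a + e)].
pose c := inf S.
have ac : a + e <= c by apply: lb_le_inf; [exists b|].
have cb : c <= b by apply: ge_inf => //; exists (a + e).
have ac' : a < c by rewrite (lt_le_trans _ ac) // ltrDl.
have cab : a <= c <= b by rewrite ltW.
have [d d0 [H1 H2]] := sgn c cab.
have [fc|fc] := leP (f c) 0.
  pose x := Num.max ((a + c) / 2) (c - d / 2).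
  have xc : x < c by rewrite /x gt_max; apply/andP; split; lra.
  have ax : a < x by rewrite /x lt_max; apply/orP; left; lra.
  have dx : c - d < x by rewrite /x lt_max; apply/orP; right; lra.
  have Sx : S x.
    split; first by rewrite ax (le_trans (ltW xc)).
    by apply/ltW/H1 => //; rewrite dx.
  have : c <= x by apply: ge_inf => //; exists (a + e).
  by rewrite leNgt xc.
have [x Sx xc] : exists2 x, S x & x < c + d by apply: inf_adherent.
have cx : c <= x by apply: ge_inf => //; exists (a + e).
by case: (Sx) => _; rewrite leNgt H2 // cx.
Qed.

End SignChange.

(** * The curve of half-returns of a node *)

Section Curve.
Variable R : realType.
Variables k1 k2 a1 a2 : R.
Implicit Types T y z b : R.

(* The pair [(yent T, zret T)] is the solution [(y, z)] of the two equations
   [y - a_i = exp (k_i T) (z - a_i)]. *)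
Definition zret T : R :=
  (a1 * (expR (k1 * T) - 1) - a2 * (expR (k2 * T) - 1)) / (expR (k1 * T) - expR (k2 * T)).
Definition yent T : R := zret (- T).
(* [- dz/dy] along the curve; it is the [u] for which [chord u] takes the same
   value at [k1 T] and [k2 T]. *)
Definition tilt T : R :=
  - ((eslope (- (k1 * T)) - eslope (- (k2 * T))) /
     (eslope (k1 * T) - eslope (k2 * T))).
(** The normalization is forced: for [b = a_i], [log_ratio] is [k_i T], and its derivative
    [k_i T * chord u (k_i T) / speed] must be [k_i]. *)
Definition speed T : R := T * chord (tilt T) (k1 * T).

Hypothesis k12 : 0 < k1 * k2.
Hypothesis k1k2 : k1 != k2.

Let k1N : k1 != 0. Proof. by apply: contraTneq k12 => ->; rewrite mul0r ltxx. Qed.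
Let k2N : k2 != 0. Proof. by apply: contraTneq k12 => ->; rewrite mulr0 ltxx. Qed.

Lemma same_side_expR T : 0 < T -> 0 < (expR (k1 * T) - 1) * (expR (k2 * T) - 1).
Proof.
move=> T0; have [k0|k0|k0] := ltgtP k1 0.
- have k20 : k2 < 0 by rewrite -(nmulr_rgt0 _ k0).
  by rewrite nmulr_rgt0 subr_lt0 expR_lt1 pmulr_llt0.
- have k20 : 0 < k2 by rewrite -(pmulr_rgt0 _ k0).
  by rewrite mulr_gt0 // subr_gt0 expR_gt1 mulr_gt0.
- by have := k1N; rewrite k0 eqxx.
Qed.

Lemma expR_sub_neq0 T : T != 0 -> expR (k1 * T) - expR (k2 * T) != 0.
Proof.
by move=> T0; rewrite subr_eq0 (inj_eq (@expR_inj R)) (inj_eq (mulIf T0)).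
Qed.

Lemma expR_sub_gt0 T : 0 < T -> 0 < (k1 - k2) * (expR (k1 * T) - expR (k2 * T)).
Proof.
move=> T0; have [k|k|k] := ltgtP k1 k2; last by have := k1k2; rewrite k eqxx.
- by rewrite nmulr_rgt0 ?subr_lt0 // ltr_expR ltr_pM2r.
- by rewrite mulr_gt0 ?subr_gt0 // ltr_expR ltr_pM2r.
Qed.

Lemma zret_rel1 T : T != 0 -> yent T - a1 = expR (k1 * T) * (zret T - a1).
Proof.
move=> T0; have D := expR_sub_neq0 T0; rewrite /yent /zret !mulrN !expRN.
have e1 := lt0r_neq0 (expR_gt0 (k1 * T)); have e2 := lt0r_neq0 (expR_gt0 (k2 * T)).
have D' : expR (k2 * T) - expR (k1 * T) != 0 by rewrite -oppr_eq0 opprB.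
by field; rewrite ?mulN1r ?e1 ?e2 ?D ?D'.
Qed.

Lemma zret_rel2 T : T != 0 -> yent T - a2 = expR (k2 * T) * (zret T - a2).
Proof.
move=> T0; have D := expR_sub_neq0 T0; rewrite /yent /zret !mulrN !expRN.
have e1 := lt0r_neq0 (expR_gt0 (k1 * T)); have e2 := lt0r_neq0 (expR_gt0 (k2 * T)).
have D' : expR (k2 * T) - expR (k1 * T) != 0 by rewrite -oppr_eq0 opprB.
by field; rewrite ?mulN1r ?e1 ?e2 ?D ?D'.
Qed.

Lemma zret_unique T y z : T != 0 ->
  y - a1 = expR (k1 * T) * (z - a1) -> y - a2 = expR (k2 * T) * (z - a2) ->
  y = yent T /\ z = zret T.
Proof.
move=> T0 E1 E2; have D := expR_sub_neq0 T0.
have zE : z = zret T.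
  apply: (mulIf D); rewrite /zret divfK //.
  have H : a1 + expR (k1 * T) * (z - a1) = a2 + expR (k2 * T) * (z - a2).
    by rewrite -E1 -E2; ring.
  lra.
split=> //; have := zret_rel1 T0; rewrite -zE -E1 => H; lra.
Qed.

Lemma gapE T : T != 0 -> zret T - yent T =
  - ((a1 - a2) * ((expR (k1 * T) - 1) * (expR (k2 * T) - 1)))
    / (expR (k1 * T) - expR (k2 * T)).
Proof.
move=> T0; have D := expR_sub_neq0 T0; rewrite /yent /zret !mulrN !expRN.
have e1 := lt0r_neq0 (expR_gt0 (k1 * T)); have e2 := lt0r_neq0 (expR_gt0 (k2 * T)).
have D' : expR (k2 * T) - expR (k1 * T) != 0 by rewrite -oppr_eq0 opprB.
by field; rewrite ?mulN1r ?e1 ?e2 ?D ?D'.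
Qed.

Lemma gap_sign T : 0 < T -> 0 < (a2 - a1) * (k1 - k2) * (zret T - yent T) \/ a1 = a2.
Proof.
move=> T0; have [->|aN] := eqVneq a1 a2; [by right|left].
have D := expR_sub_gt0 T0; have P := same_side_expR T0.
have DN := expR_sub_neq0 (lt0r_neq0 T0).
rewrite gapE ?lt0r_neq0 //.
have -> : (a2 - a1) * (k1 - k2) *
  (- ((a1 - a2) * ((expR (k1 * T) - 1) * (expR (k2 * T) - 1))) /
     (expR (k1 * T) - expR (k2 * T))) =
  (a2 - a1) ^+ 2 * ((expR (k1 * T) - 1) * (expR (k2 * T) - 1)) *
   ((k1 - k2) * (expR (k1 * T) - expR (k2 * T))) /
     (expR (k1 * T) - expR (k2 * T)) ^+ 2 by field.
rewrite divr_gt0 ?exprn_even_gt0 // mulr_gt0 // mulr_gt0 // exprn_even_gt0 //=.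
by rewrite subr_eq0 eq_sym.
Qed.

Lemma eslope_diff_neq0 T : 0 < T -> eslope (k1 * T) - eslope (k2 * T) != 0.
Proof.
move=> T0; rewrite subr_eq0; have S : forall x y : R, x < y -> 0 < x * y -> eslope x < eslope y.
  move=> x y xy p; apply: eslope_lt => //.
  have [x0|x0] := ltP 0 x; [by left|right].
  by move: p; rewrite ltNge => /negP h; rewrite ltNge; apply/negP => y0; apply: h; rewrite mulr_le0_ge0.
have P : 0 < (k1 * T) * (k2 * T) by rewrite mulrACA mulr_gt0 // mulr_gt0.
have [k|k|k] := ltgtP k1 k2; last by have := k1k2; rewrite k eqxx.
- by rewrite lt_eqF // S // ltr_pM2r.
- by rewrite gt_eqF // S ?ltr_pM2r // mulrC.
Qed.

Lemma kT_neq0 T : 0 < T -> k1 * T != 0 /\ k2 * T != 0.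
Proof. by move=> T0; rewrite !mulf_neq0 // gt_eqF. Qed.

Lemma eslope_oppdiff T : 0 < T ->
  (eslope (- (k1 * T)) - eslope (- (k2 * T))) * (eslope (k1 * T) - eslope (k2 * T)) < 0.
Proof.
move=> T0; have S x y : x < y -> 0 < x * y ->
    eslope x < eslope y /\ eslope (- y) < eslope (- x).
  move=> xy p; have h : 0 < x \/ y < 0.
    have [x0|x0] := ltP 0 x; [by left|right].
    by move: p; rewrite ltNge => /negP h; rewrite ltNge; apply/negP => y0; apply: h; rewrite mulr_le0_ge0.
  split; apply: eslope_lt => //; first by rewrite ltrN2.
  by rewrite oppr_gt0 oppr_lt0; case: h; [right|left].
have P : 0 < (k1 * T) * (k2 * T) by rewrite mulrACA mulr_gt0 // mulr_gt0.
have [k|k|k] := ltgtP k1 k2; last by have := k1k2; rewrite k eqxx.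
- have [|//|h1 h2] := S (k1 * T) (k2 * T); first by rewrite ltr_pM2r.
  by rewrite pmulr_rlt0 ?subr_gt0 ?subr_lt0.
- have [||h1 h2] := S (k2 * T) (k1 * T); rewrite ?ltr_pM2r //; first by rewrite mulrC.
  by rewrite nmulr_rlt0 ?subr_lt0 ?subr_gt0.
Qed.

Lemma tilt_gt0 T : 0 < T -> 0 < tilt T.
Proof.
move=> T0; have N := eslope_oppdiff T0; have D := eslope_diff_neq0 T0.
rewrite /tilt; set a := (_ - _) in N *; set b := (_ - _) in N D *.
have -> : - (a / b) = - (a * b) / b ^+ 2 by field.
by rewrite divr_gt0 ?oppr_gt0 // exprn_even_gt0.
Qed.

Lemma chord_tilt T : 0 < T -> chord (tilt T) (k1 * T) = chord (tilt T) (k2 * T).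
Proof.
move=> T0; have D := eslope_diff_neq0 T0; rewrite /chord.
suff : tilt T * (eslope (k1 * T) - eslope (k2 * T)) =
  - (eslope (- (k1 * T)) - eslope (- (k2 * T))) by move=> H; lra.
by rewrite /tilt mulNr divfK.
Qed.

Lemma chord_gt0 (u x : R) : 0 < u -> x != 0 -> 0 < chord u x.
Proof.
move=> u0 x0; apply: addr_gt0; first by apply: mulr_gt0 => //; exact: eslope_gt0.
by apply: eslope_gt0; rewrite oppr_eq0.
Qed.

Lemma speed_gt0 T : 0 < T -> 0 < speed T.
Proof.
by move=> T0; rewrite mulr_gt0 // chord_gt0 ?tilt_gt0 // (kT_neq0 T0).1.
Qed.

(** [P] and [Q] are, up to nonzero factors, the two differences of [eslope] in [tilt]. They make
    [tilt] and [speed] rational in the exponentials, within reach of [field]. *)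
Let P T := k1 * expR (k1 * T) * (expR (k2 * T) - 1) - k2 * expR (k2 * T) * (expR (k1 * T) - 1).
Let Q T := k1 * (expR (k2 * T) - 1) - k2 * (expR (k1 * T) - 1).

Let Q_neq0 T : 0 < T -> Q T != 0.
Proof.
move=> T0; have := eslope_diff_neq0 T0; have TN := lt0r_neq0 T0.
have -> : eslope (k1 * T) - eslope (k2 * T) = - Q T / (k1 * k2 * T).
  by rewrite /eslope /Q; field; rewrite ?k1N ?k2N ?TN.
by apply: contraNneq => ->; rewrite oppr0 mul0r.
Qed.

Let tiltE T : 0 < T -> tilt T = - P T / (Q T * expR (k1 * T) * expR (k2 * T)).
Proof.
move=> T0; have TN := lt0r_neq0 T0; have QN := Q_neq0 T0.
have e1 := lt0r_neq0 (expR_gt0 (k1 * T)); have e2 := lt0r_neq0 (expR_gt0 (k2 * T)).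
have D1 : eslope (k1 * T) - eslope (k2 * T) = - Q T / (k1 * k2 * T).
  by rewrite /eslope /Q; field; rewrite ?k1N ?k2N ?TN.
have D2 : eslope (- (k1 * T)) - eslope (- (k2 * T)) =
    - P T / (k1 * k2 * T * expR (k1 * T) * expR (k2 * T)).
  by rewrite /eslope /P !expRN; field; rewrite ?k1N ?k2N ?TN ?e1 ?e2.
by rewrite /tilt D1 D2; field; rewrite ?k1N ?k2N ?TN ?e1 ?e2 ?QN.
Qed.

Let speedE T : 0 < T -> speed T =
  (expR (k1 * T) - 1) * (1 - expR (k2 * T)) * (expR (k1 * T) - expR (k2 * T))
   / (Q T * expR (k1 * T) * expR (k2 * T)).
Proof.
move=> T0; have TN := lt0r_neq0 T0; have QN := Q_neq0 T0.
have e1 := lt0r_neq0 (expR_gt0 (k1 * T)); have e2 := lt0r_neq0 (expR_gt0 (k2 * T)).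
rewrite /speed /chord tiltE // /eslope expRN.
transitivity ((expR (k1 * T) - 1) * (Q T * expR (k2 * T) - P T) / (k1 * Q T * expR (k1 * T) * expR (k2 * T))).
  by field; rewrite ?k1N ?k2N ?TN ?e1 ?e2 ?QN.
have -> : Q T * expR (k2 * T) - P T = k1 * (expR (k1 * T) - expR (k2 * T)) * (1 - expR (k2 * T)).
  by rewrite /Q /P; ring.
by field; rewrite ?k1N ?k2N ?TN ?e1 ?e2 ?QN.
Qed.

Let der_zret0 T : T != 0 -> is_derive T 1 zret
  (- (a1 - a2) * P T / (expR (k1 * T) - expR (k2 * T)) ^+ 2).
Proof.
move=> T0; have D := expR_sub_neq0 T0.
by rewrite /zret; der; rewrite /P; field; rewrite ?mulN1r.
Qed.

Lemma der_zret T : 0 < T -> is_derive T 1 zret (tilt T * (zret T - yent T) / speed T).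
Proof.
move=> T0; have TN := lt0r_neq0 T0; apply: (der_eq (der_zret0 TN)).
have QN := Q_neq0 T0; have D := expR_sub_neq0 TN.
have S := same_side_expR T0.
have e1N : expR (k1 * T) - 1 != 0 by apply: contraTneq S => ->; rewrite mul0r ltxx.
have e2N : expR (k2 * T) - 1 != 0 by apply: contraTneq S => ->; rewrite mulr0 ltxx.
have e2N' : 1 - expR (k2 * T) != 0 by rewrite -oppr_eq0 opprB.
have e1 := lt0r_neq0 (expR_gt0 (k1 * T)); have e2 := lt0r_neq0 (expR_gt0 (k2 * T)).
rewrite tiltE // gapE // speedE //.
by field; rewrite ?mulN1r ?e1 ?e2 ?e1N ?e2N ?e2N' ?D ?QN.
Qed.

Lemma der_yent T : 0 < T -> is_derive T 1 yent (- (zret T - yent T) / speed T).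
Proof.
move=> T0; have TN := lt0r_neq0 T0; have TN' : - T != 0 by rewrite oppr_eq0.
have H := der_comp (der_zret0 TN') (derN (der_id T)).
apply: (der_eq H); have QN := Q_neq0 T0; have D := expR_sub_neq0 TN.
have S := same_side_expR T0.
have e1N : expR (k1 * T) - 1 != 0 by apply: contraTneq S => ->; rewrite mul0r ltxx.
have e2N : expR (k2 * T) - 1 != 0 by apply: contraTneq S => ->; rewrite mulr0 ltxx.
have e2N' : 1 - expR (k2 * T) != 0 by rewrite -oppr_eq0 opprB.
have e1 := lt0r_neq0 (expR_gt0 (k1 * T)); have e2 := lt0r_neq0 (expR_gt0 (k2 * T)).
have D' : expR (k2 * T) - expR (k1 * T) != 0 by rewrite -oppr_eq0 opprB.
rewrite gapE // speedE // /P !mulrN !expRN.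
have -> : k1 * (expR (k1 * T))^-1 * ((expR (k2 * T))^-1 - 1) -
   k2 * (expR (k2 * T))^-1 * ((expR (k1 * T))^-1 - 1) =
   - Q T / (expR (k1 * T) * expR (k2 * T)).
  by rewrite /Q; field; rewrite ?e1 ?e2.
by field; rewrite ?mulN1r ?e1 ?e2 ?e1N ?e2N ?e2N' ?D ?D' ?QN.
Qed.

(** As [eslope' x = (exp x - eslope x) / x], the derivative contains a difference of
    [u exp x + exp (- x)], which gives [contact], and a difference of [chord u], which vanishes by
    [chord_tilt]. *)
Lemma der_tilt T : 0 < T ->
  is_derive T 1 tilt (- contact (tilt T) (k1 * T) (k2 * T) / speed T).
Proof.
move=> T0; have TN := lt0r_neq0 T0; have D := eslope_diff_neq0 T0.
have [x1N x2N] := kT_neq0 T0.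
have x1N' : - (k1 * T) != 0 by rewrite oppr_eq0.
have x2N' : - (k2 * T) != 0 by rewrite oppr_eq0.
have L k : is_derive T 1 (fun y => k * y) k by der; ring.
have L' k : is_derive T 1 (fun y => - (k * y)) (- k) by der; ring.
have d1 := @der_eslope _ (fun y => k1 * y) T k1 x1N (L k1); have d2 := @der_eslope _ (fun y => k2 * y) T k2 x2N (L k2).
have d1' := @der_eslope _ (fun y => - (k1 * y)) T (- k1) x1N' (L' k1); have d2' := @der_eslope _ (fun y => - (k2 * y)) T (- k2) x2N' (L' k2).
have cN : chord (tilt T) (k1 * T) != 0 by rewrite gt_eqF // chord_gt0 ?tilt_gt0.
have E := chord_tilt T0.
have d3 := @derV _ (fun y => eslope (k1 * y) - eslope (k2 * y)) T _ D (derD d1 (derN d2)).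
have H := derN (derM (derD d1' (derN d2')) d3).
rewrite /tilt; apply: (der_eq H); rewrite -/(tilt T) /contact /speed.
have uE : eslope (- (k1 * T)) - eslope (- (k2 * T)) =
  - tilt T * (eslope (k1 * T) - eslope (k2 * T)).
  by rewrite /tilt opprK divfK.
rewrite uE; move: E; rewrite /chord => E.
transitivity (- ((tilt T * expR (k1 * T) + expR (- (k1 * T)))
   - (tilt T * expR (k2 * T) + expR (- (k2 * T))) -
   ((tilt T * eslope (k1 * T) + eslope (- (k1 * T))) - (tilt T * eslope (k2 * T) + eslope (- (k2 * T)))))
   / (T * (eslope (k1 * T) - eslope (k2 * T)))).
  by field; rewrite ?TN ?k1N ?k2N ?D.
by rewrite E subrr subr0 -E; rewrite /chord in cN; field; rewrite ?cN ?TN ?D.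
Qed.

End Curve.

(** * Intersections of two curves of half-returns *)

Section TwoCurves.
Variable R : realType.
Implicit Types T y z b x c : R.

Definition log_ratio y z b : R := ln ((b - y) / (b - z)).

Lemma log_ratio_rel y z b x : y < z -> x != 0 -> y - b = expR x * (z - b) ->
  [/\ 0 < x -> z < b, x < 0 -> b < y & log_ratio y z b = x].
Proof.
move=> yz x0 E; have e0 := expR_gt0 x.
have E' : (expR x - 1) * (z - b) = y - z by rewrite mulrBl -E; ring.
have zb : z - b != 0.
  by apply: contraTneq yz => h; move: E'; rewrite h mulr0 => h'; rewrite -leNgt; lra.
have N : (expR x - 1) * (z - b) < 0 by rewrite E' subr_lt0.
split=> [xp|xn|].
- by move: N; rewrite pmulr_rlt0 ?subr_gt0 ?expR_gt1 // subr_lt0.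
- move: N; rewrite nmulr_rlt0 ?subr_lt0 ?expR_lt1 // => h.
  by rewrite -subr_gt0 E mulr_gt0.
- rewrite /log_ratio -[b - y]opprB -[b - z]opprB E -mulrN mulfK ?expRK //.
  by rewrite oppr_eq0.
Qed.

Lemma ratio_gt0 y z b : y < z -> z < b \/ b < y -> 0 < (b - y) / (b - z).
Proof.
move=> yz [zb|by_]; first by rewrite divr_gt0 // subr_gt0 // (lt_trans yz).
by rewrite -mulrNN -invrN divr_gt0 // opprB subr_gt0 // (lt_trans by_).
Qed.

Lemma log_ratio_gt0 y z b : y < z -> z < b -> 0 < log_ratio y z b.
Proof.
move=> yz zb; rewrite ln_gt0 // ltr_pdivlMr ?subr_gt0 // mul1r; lra.
Qed.

Lemma log_ratio_lt0 y z b : y < z -> b < y -> log_ratio y z b < 0.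
Proof.
move=> yz zb; rewrite ln_lt0 // ratio_gt0 /=; [|done|by right].
by rewrite -mulrNN -invrN ltr_pdivrMr ?mul1r; lra.
Qed.

Lemma log_ratio_lt y z b c : y < z -> b < c -> z < b \/ c < y ->
  log_ratio y z c < log_ratio y z b.
Proof.
move=> yz bc H; rewrite ltr_ln ?posrE; first last.
- by apply: ratio_gt0 => //; case: H => ?; [left|right; apply: lt_trans bc _].
- by apply: ratio_gt0 => //; case: H => ?; [left; apply: lt_trans bc|right].
have P : 0 < (b - z) * (c - z) by case: H => ?; [rewrite mulr_gt0|rewrite nmulr_rgt0]; lra.
rewrite -subr_gt0.
have bN : b - z != 0 by apply: contraTneq P => ->; rewrite mul0r ltxx.
have cN : c - z != 0 by apply: contraTneq P => ->; rewrite mulr0 ltxx.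
have -> : (b - y) / (b - z) - (c - y) / (c - z) =
   (z - y) * (c - b) / ((b - z) * (c - z)) by field; rewrite bN cN.
by rewrite divr_gt0 // mulr_gt0 // subr_gt0.
Qed.

Lemma log_ratio_inj y z b c : y < z -> (z < b /\ z < c) \/ (b < y /\ c < y) ->
  log_ratio y z b = log_ratio y z c -> b = c.
Proof.
move=> yz H E; have [h|h|//] := ltgtP b c.
- have := @log_ratio_lt y z b c yz h; rewrite E ltxx => F.
  by have : false by apply: F; case: H => -[? ?]; [left|right].
- have := @log_ratio_lt y z c b yz h; rewrite E ltxx => F.
  by have : false by apply: F; case: H => -[? ?]; [left|right].
Qed.

(* The last condition says that [y < z] along the curve. *)
Definition node_data (k1 k2 a1 a2 : R) : Prop :=
  [/\ 0 < k1 * k2, k2 ^+ 2 < k1 ^+ 2 & 0 < (a2 - a1) * (k1 - k2)].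

Lemma node_dataP k1 k2 a1 a2 : node_data k1 k2 a1 a2 ->
  [/\ 0 < k2, k2 < k1 & a1 < a2] \/ [/\ k2 < 0, k1 < k2 & a2 < a1].
Proof.
case=> k12 k21 a; have [k0|k0|k0] := ltgtP k1 0.
- have k20 : k2 < 0 by rewrite -(nmulr_rgt0 _ k0).
  have kk : k1 < k2 by nra.
  by right; split => //; move: a; rewrite nmulr_lgt0 ?subr_lt0.
- have k20 : 0 < k2 by rewrite -(pmulr_rgt0 _ k0).
  have kk : k2 < k1 by nra.
  by left; split => //; move: a; rewrite pmulr_lgt0 ?subr_gt0.
- by move: k12; rewrite k0 mul0r ltxx.
Qed.

Variables k1 k2 a1 a2 j1 j2 b1 b2 : R.
Hypothesis Hk : node_data k1 k2 a1 a2.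
Hypothesis Hj : node_data j1 j2 b1 b2.

Let k12 : 0 < k1 * k2. Proof. by case: Hk. Qed.
Let k1k2 : k1 != k2. Proof. by case: Hk => _ h _; apply: contraTneq h => ->; rewrite ltxx. Qed.

Let Y := yent k1 k2 a1 a2.
Let Z := zret k1 k2 a1 a2.
Let u := tilt k1 k2.
Let nu := speed k1 k2.
Let B b T := log_ratio (Y T) (Z T) b.

Lemma gap_gt0 T : 0 < T -> Y T < Z T.
Proof.
move=> T0; case: Hk => _ _ a; have [|E] := gap_sign a1 a2 k12 k1k2 T0.
  by rewrite pmulr_rgt0 // subr_gt0.
by move: a; rewrite E subrr mul0r ltxx.
Qed.

Lemma yent_lt T T' : 0 < T -> T < T' -> Y T' < Y T.
Proof.
move=> T0 TT; rewrite -ltrN2.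
have D t : T <= t <= T' -> is_derive t 1 (fun t => - Y t) (- (- (Z t - Y t) / nu t)).
  by move=> /andP[h _]; apply: derN; apply: der_yent => //; exact: lt_le_trans h.
apply: (der_increasing TT D) => t /andP[h _].
have t0 := lt_trans T0 h.
rewrite mulNr opprK; apply: divr_gt0; last exact: speed_gt0.
by rewrite subr_gt0 gap_gt0.
Qed.

Lemma zret_lt T T' : 0 < T -> T < T' -> Z T < Z T'.
Proof.
move=> T0 TT.
have D t : T <= t <= T' -> is_derive t 1 Z (u t * (Z t - Y t) / nu t).
  by move=> /andP[h _]; apply: der_zret => //; exact: lt_le_trans h.
apply: (der_increasing TT D) => t /andP[h _].
have t0 := lt_trans T0 h.
apply: divr_gt0; last exact: speed_gt0.
apply: mulr_gt0; first exact: tilt_gt0.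
by rewrite subr_gt0 gap_gt0.
Qed.

Definition outside b T : Prop := Z T < b \/ b < Y T.

Lemma der_log_ratio b T : 0 < T -> outside b T ->
  is_derive T 1 (B b) (B b T * chord (u T) (B b T) / nu T).
Proof.
move=> T0 bT; have g := gap_gt0 T0; have r := ratio_gt0 g bT.
have BN : B b T != 0.
  by case: bT => h; [rewrite gt_eqF // log_ratio_gt0|rewrite lt_eqF // log_ratio_lt0].
have nN := lt0r_neq0 (speed_gt0 k12 k1k2 T0 : 0 < nu T).
have dY : is_derive T 1 Y (- (Z T - Y T) / nu T) by apply: der_yent.
have dZ : is_derive T 1 Z (u T * (Z T - Y T) / nu T) by apply: der_zret.
have bzN : b - Z T != 0.
  by apply: contraTneq r => ->; rewrite invr0 mulr0 ltxx.
have byN : b - Y T != 0 by apply: contraTneq r => ->; rewrite mul0r ltxx.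
have eB : expR (B b T) = (b - Y T) / (b - Z T) by rewrite lnK.
have -> : B b T * chord (u T) (B b T) =
   u T * (expR (B b T) - 1) + (1 - (expR (B b T))^-1).
  by rewrite /chord /eslope expRN; field; rewrite ?BN (gt_eqF (expR_gt0 _)).
rewrite eB /B /log_ratio.
have dz := @derV _ (fun t => b - Z t) T _ bzN (derD (der_cst b T) (derN dZ)).
apply: (der_eq (@der_ln _ (fun t => (b - Y t) / (b - Z t)) T _ r
  (derM (derD (der_cst b T) (derN dY)) dz))).
by field; rewrite ?byN ?bzN ?nN.
Qed.

(** [J / nu] is the logarithmic derivative of [B b1 / B b2], by [der_log_ratio]. *)
Let J T := chord (u T) (B b1 T) - chord (u T) (B b2 T).
Let du T := - contact (u T) (k1 * T) (k2 * T) / nu T.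
Let dchord b T := du T * eslope (B b T) +
  ((u T * expR (B b T) + expR (- B b T)) - chord (u T) (B b T)) * chord (u T) (B b T) / nu T.

Lemma der_chord b T : 0 < T -> outside b T ->
  is_derive T 1 (fun t => chord (u t) (B b t)) (dchord b T).
Proof.
move=> T0 bT; have g := gap_gt0 T0.
have BN : B b T != 0.
  by case: bT => h; [rewrite gt_eqF // log_ratio_gt0|rewrite lt_eqF // log_ratio_lt0].
have BN' : - B b T != 0 by rewrite oppr_eq0.
have nN := lt0r_neq0 (speed_gt0 k12 k1k2 T0 : 0 < nu T).
have dB := der_log_ratio T0 bT.
have dU : is_derive T 1 u (du T) by apply: der_tilt.
have d1 := @der_eslope _ (B b) T _ BN dB.
have d2 := @der_eslope _ (fun t => - B b t) T _ BN' (derN dB).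
apply: (der_eq (derD (derM dU d1) d2)); rewrite /dchord.
have -> : chord (u T) (B b T) = u T * eslope (B b T) + eslope (- B b T) by [].
by field; rewrite ?BN ?nN.
Qed.

Lemma der_J T : 0 < T -> outside b1 T -> outside b2 T ->
  is_derive T 1 J (dchord b1 T - dchord b2 T).
Proof. by move=> T0 o1 o2; apply: derD (der_chord T0 o1) (derN (der_chord T0 o2)). Qed.

(** At a zero of [J], the curve with centres [b_i] through the same point has the same slope. The
    two contacts are the second derivatives of both curves, up to the common factor [y - z]. *)
Lemma dJ_zero T : 0 < T -> eslope (B b1 T) - eslope (B b2 T) != 0 -> J T = 0 ->
  dchord b1 T - dchord b2 T = (eslope (B b1 T) - eslope (B b2 T)) *
   (contact (u T) (B b1 T) (B b2 T) - contact (u T) (k1 * T) (k2 * T)) / nu T.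
Proof.
move=> T0 D /eqP; rewrite subr_eq0 => /eqP E.
have nN := lt0r_neq0 (speed_gt0 k12 k1k2 T0 : 0 < nu T).
rewrite /dchord /du -E [contact (u T) (B b1 T) (B b2 T)]/contact.
by field; rewrite ?D ?nN.
Qed.

Definition sided T : Prop :=
  (0 < j1 -> Z T < b1 /\ Z T < b2) /\ (j1 < 0 -> b1 < Y T /\ b2 < Y T).

(** The interval from [Y T] to [Z T] grows with [T]. *)
Lemma sided_le T T' : 0 < T -> T <= T' -> sided T' -> sided T.
Proof.
move=> T0; rewrite le_eqVlt => /orP[/eqP -> //|TT] [h1 h2].
have hy := yent_lt T0 TT; have hz := zret_lt T0 TT.
by split=> h; [have [? ?] := h1 h|have [? ?] := h2 h]; split; lra.
Qed.

Lemma sided_outside T : sided T -> outside b1 T /\ outside b2 T.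
Proof.
case=> h1 h2; case: (node_dataP Hj) => -[j20 j21 _].
  by have [? ?] := h1 (lt_trans j20 j21); split; left.
by have [? ?] := h2 (lt_trans j21 j20); split; right.
Qed.

Lemma mul4_gt0 x y c z T : 0 < T -> 0 < x * z -> 0 < y * c -> 0 < x * y * (c * z / T).
Proof.
move=> T0 h1 h2; rewrite (_ : x * y * (c * z / T) = x * z * (y * c) / T); last by ring.
by rewrite divr_gt0 // mulr_gt0.
Qed.

(* The sign of the derivative of [J] at its zeros does not depend on the zero. *)
Lemma dJ_sign T : 0 < T -> sided T -> J T = 0 -> ~ (a1 = b1 /\ a2 = b2) ->
  0 < (a1 - b1) * j1 * (dchord b1 T - dchord b2 T) /\
  contact (u T) (B b1 T) (B b2 T) != contact (u T) (k1 * T) (k2 * T).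
Proof.
move=> T0 sT JT ab; have g := gap_gt0 T0.
have u0 : 0 < u T by apply: tilt_gt0.
have nu0 : 0 < nu T by apply: speed_gt0.
have Ek : chord (u T) (k1 * T) = chord (u T) (k2 * T) by apply: chord_tilt.
have TN := lt0r_neq0 T0.
have R1 : Y T - a1 = expR (k1 * T) * (Z T - a1) by apply: zret_rel1.
have R2 : Y T - a2 = expR (k2 * T) * (Z T - a2) by apply: zret_rel2.
have [[h1 h2] Ej] := (sT, JT).
move/eqP: Ej; rewrite subr_eq0 => /eqP Ej.
case: (node_dataP Hk) => -[k20 k21 a12]; case: (node_dataP Hj) => -[j20 j21 b12].
- have [zb1 zb2] := h1 (lt_trans j20 j21).
  have k1T : 0 < k1 * T by rewrite mulr_gt0 // (lt_trans k20).
  have k2T : 0 < k2 * T by rewrite mulr_gt0.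
  have [A1 _ L1] := log_ratio_rel g (lt0r_neq0 k1T) R1; have {}A1 := A1 k1T.
  have [A2 _ L2] := log_ratio_rel g (lt0r_neq0 k2T) R2; have {}A2 := A2 k2T.
  have kT : k2 * T < k1 * T by rewrite ltr_pM2r.
  have B2 : 0 < B b2 T by apply: log_ratio_gt0.
  have B12 : B b2 T < B b1 T by apply: log_ratio_lt => //; left.
  have D : 0 < eslope (B b1 T) - eslope (B b2 T) by rewrite subr_gt0 eslope_lt //; left.
  have j10 := lt_trans j20 j21.
  rewrite dJ_zero ?lt0r_neq0 //.
  (* [log_ratio] decreases with the centre, so [b1 < a1] means that [k1 T < B b1 T]: the pair of the
     curve is the inner one. Equal first centres give equal first members, hence equal pairs and
     equal second centres, which is excluded. *)
  have [ba|ba|ba] := ltgtP b1 a1.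
  + have W : contact (u T) (k1 * T) (k2 * T) < contact (u T) (B b1 T) (B b2 T).
      apply: contact_lt => //; rewrite -L1; apply: log_ratio_lt => //; by left.
    rewrite (gt_eqF W) mul4_gt0 //; last exact: mulr_gt0.
    by apply: mulr_gt0; rewrite subr_gt0.
  + have W : contact (u T) (B b1 T) (B b2 T) < contact (u T) (k1 * T) (k2 * T).
      apply: contact_lt => //; rewrite -L1; apply: log_ratio_lt => //; by left.
    rewrite (lt_eqF W) mul4_gt0 //; last exact: mulr_gt0.
    by rewrite nmulr_rgt0 subr_lt0.
  + exfalso; apply: ab; split=> //; apply: (log_ratio_inj g); first by left.
    have BE : B b1 T = k1 * T by rewrite /B ba L1.
    rewrite L2; apply: (chord_pair_unique u0 k2T kT Ek B2); first by rewrite -BE.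
    by rewrite -Ej BE.
(* Rates of opposite signs: the pair of the curve requires [u < 1], the other one [1 < u]. *)
- have [zb1 zb2] := h2 (lt_trans j21 j20).
  have k1T : 0 < k1 * T by rewrite mulr_gt0 // (lt_trans k20).
  have kT : k2 * T < k1 * T by rewrite ltr_pM2r.
  have u1 := chord_pair_lt1 u0 (mulr_gt0 k20 T0) kT Ek.
  have B2 : B b2 T < 0 by apply: log_ratio_lt0.
  have B12 : B b1 T < B b2 T by apply: log_ratio_lt => //; right.
  by have := chord_pair_gt1 u0 B12 B2 Ej; rewrite ltNge (ltW u1).
- have [zb1 zb2] := h1 (lt_trans j20 j21).
  have k1T : k1 * T < 0 by rewrite pmulr_llt0 // (lt_trans k21).
  have kT : k1 * T < k2 * T by rewrite ltr_pM2r.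
  have k2T : k2 * T < 0 by rewrite pmulr_llt0.
  have u1 := chord_pair_gt1 u0 kT k2T Ek.
  have B2 : 0 < B b2 T by apply: log_ratio_gt0.
  have B12 : B b2 T < B b1 T by apply: log_ratio_lt => //; left.
  by have := chord_pair_lt1 u0 B2 B12 Ej; rewrite ltNge (ltW u1).
- have [zb1 zb2] := h2 (lt_trans j21 j20).
  have k1T : k1 * T < 0 by rewrite pmulr_llt0 // (lt_trans k21).
  have k2T : k2 * T < 0 by rewrite pmulr_llt0.
  have [_ A1 L1] := log_ratio_rel g (ltr0_neq0 k1T) R1; have {}A1 := A1 k1T.
  have [_ A2 L2] := log_ratio_rel g (ltr0_neq0 k2T) R2; have {}A2 := A2 k2T.
  have kT : k1 * T < k2 * T by rewrite ltr_pM2r.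
  have B2 : B b2 T < 0 by apply: log_ratio_lt0.
  have B12 : B b1 T < B b2 T by apply: log_ratio_lt => //; right.
  have D : eslope (B b1 T) - eslope (B b2 T) < 0 by rewrite subr_lt0 eslope_lt //; right.
  have j10 := lt_trans j21 j20.
  rewrite dJ_zero ?ltr0_neq0 //.
  have [ba|ba|ba] := ltgtP b1 a1.
  + have W : contact (u T) (k1 * T) (k2 * T) < contact (u T) (B b1 T) (B b2 T).
      apply: contact_gt => //; rewrite -L1; apply: log_ratio_lt => //; by right.
    rewrite (gt_eqF W) mul4_gt0 //; first by apply: mulr_gt0; rewrite subr_gt0.
    by rewrite nmulr_rgt0.
  + have W : contact (u T) (B b1 T) (B b2 T) < contact (u T) (k1 * T) (k2 * T).
      apply: contact_gt => //; rewrite -L1; apply: log_ratio_lt => //; by right.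
    rewrite (lt_eqF W) mul4_gt0 //; last by rewrite nmulr_rgt0.
    by rewrite nmulr_rgt0 subr_lt0.
  + exfalso; apply: ab; split=> //; apply: (log_ratio_inj g); first by right.
    have BE : B b1 T = k1 * T by rewrite /B ba L1.
    rewrite L2; apply: (chord_pair_uniqueN u0 kT k2T Ek) => //; first by rewrite -BE.
    by rewrite -Ej BE.
Qed.

(** By [dJ_sign], [(a1 - b1) * j1 * J] crosses zero only upwards. *)
Lemma J_zero_unique T T' : 0 < T -> T < T' -> sided T' -> J T = 0 -> J T' = 0 ->
  ~ (a1 = b1 /\ a2 = b2) -> False.
Proof.
move=> T0 TT sT JT JT' ab; pose c := (a1 - b1) * j1.
have sd t : T <= t <= T' -> 0 < t /\ sided t.
  by move=> /andP[h1 h2]; have t0 := lt_le_trans T0 h1; split=> //; exact: sided_le sT.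
apply: (@upcrossing_unique _ (fun t => c * J t) (fun t => c * (dchord b1 t - dchord b2 t)) _ _ TT).
- move=> t /sd[t0 st]; have [w1 w2] := sided_outside st.
  by apply: (der_eq (derM (der_cst c t) (der_J t0 w1 w2))); rewrite mul0r add0r.
- move=> t /sd[t0 st] /eqP; rewrite mulf_eq0 => /orP[/eqP c0|/eqP Jt].
    have [] := dJ_sign T0 (sd T _).2 JT ab; first by rewrite lexx ltW.
    by rewrite -/c c0 mul0r ltxx.
  exact: (dJ_sign t0 st Jt ab).1.
- by rewrite JT mulr0.
- by rewrite JT' mulr0.
Qed.

End TwoCurves.

(** * Counting the intersections *)

Section Cycles.
Variable R : realType.
Variables k1 k2 a1 a2 j1 j2 b1 b2 : R.
Implicit Types T y z b x c : R.

(* The point of parameter [T] of the curve with data [k_i], [a_i] is the point of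
   parameter [T'] of the curve with data [j_i], [b_i]. *)
Definition closing T T' : Prop :=
  [/\ 0 < T, 0 < T',
      yent k1 k2 a1 a2 T - b1 = expR (j1 * T') * (zret k1 k2 a1 a2 T - b1) &
      yent k1 k2 a1 a2 T - b2 = expR (j2 * T') * (zret k1 k2 a1 a2 T - b2)].

Hypothesis Hk : node_data k1 k2 a1 a2.
Hypothesis Hj : node_data j1 j2 b1 b2.
Hypothesis ab : ~ (a1 = b1 /\ a2 = b2).

Let k12 : 0 < k1 * k2. Proof. by case: Hk. Qed.
Let k1k2 : k1 != k2. Proof. by case: Hk => _ h _; apply: contraTneq h => ->; rewrite ltxx. Qed.
Let j12 : 0 < j1 * j2. Proof. by case: Hj. Qed.
Let j1j2 : j1 != j2. Proof. by case: Hj => _ h _; apply: contraTneq h => ->; rewrite ltxx. Qed.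

Let Y := yent k1 k2 a1 a2.
Let Z := zret k1 k2 a1 a2.
Let u := tilt k1 k2.
Let nu := speed k1 k2.
Let B b T := log_ratio (Y T) (Z T) b.
Let J T := chord (u T) (B b1 T) - chord (u T) (B b2 T).

Lemma closing_sided T T' : closing T T' ->
  [/\ sided k1 k2 a1 a2 j1 b1 b2 T, B b1 T = j1 * T' & B b2 T = j2 * T'].
Proof.
case=> T0 T0' E1 E2; have g := gap_gt0 Hk T0.
have [j1T j2T] := kT_neq0 j12 T0'.
have [p1 n1 L1] := log_ratio_rel g j1T E1; have [p2 n2 L2] := log_ratio_rel g j2T E2.
split=> //; split=> j0.
- have j20 : 0 < j2 by rewrite -(pmulr_rgt0 _ j0).
  by split; [apply: p1|apply: p2]; rewrite mulr_gt0.
- have j20 : j2 < 0 by rewrite -(nmulr_rgt0 _ j0).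
  by split; [apply: n1|apply: n2]; rewrite pmulr_llt0.
Qed.

Lemma closing_rolle T1 T1' T2 T2' : closing T1 T1' -> closing T2 T2' -> T1 < T2 ->
  exists2 T, T1 < T < T2 & J T = 0.
Proof.
move=> C1 C2 T12; have [s1 L11 L12] := closing_sided C1.
have [s2 L21 L22] := closing_sided C2.
case: (C1) (C2) => T10 T10' _ _ [T20 T20' _ _].
have sd t : T1 <= t <= T2 -> 0 < t /\ sided k1 k2 a1 a2 j1 b1 b2 t.
  move=> /andP[h1 h2]; have t0 := lt_le_trans T10 h1; split=> //.
  exact: (sided_le Hk t0 h2 s2).
have BN b t : 0 < t -> outside k1 k2 a1 a2 b t -> B b t != 0.
  move=> t0 [h|h]; have g := gap_gt0 Hk t0.
    by rewrite gt_eqF // log_ratio_gt0.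
  by rewrite lt_eqF // log_ratio_lt0.
have [j1T1 j2T1] := kT_neq0 j12 T10'; have [j1T2 j2T2] := kT_neq0 j12 T20'.
pose f t := B b1 t / B b2 t.
pose df t := B b1 t * J t / (nu t * B b2 t).
have [||T Tin] := @rolle _ f df _ _ T12.
- move=> t /sd[t0 st]; have [w1 w2] := sided_outside Hj st.
  have B2N := BN _ _ t0 w2; have nN := lt0r_neq0 (speed_gt0 k12 k1k2 t0 : 0 < nu t).
  have D : is_derive t 1 f (B b1 t * chord (u t) (B b1 t) / nu t * (B b2 t)^-1 +
      B b1 t * (- (B b2 t * chord (u t) (B b2 t) / nu t) / B b2 t ^+ 2)).
    exact: derM (der_log_ratio Hk t0 w1) (derV B2N (der_log_ratio Hk t0 w2)).
  apply: (der_eq D).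
  by rewrite /df /J; field; rewrite ?B2N ?nN.
- rewrite /f L11 L12 L21 L22; have [j1N j2N] := kT_neq0 j12 (ltr01 : 0 < 1 :> R).
  have T1N := lt0r_neq0 T10'; have T2N := lt0r_neq0 T20'.
  by rewrite !mulr1 in j1N j2N; field; rewrite ?T1N ?T2N ?j2N.
have /sd[t0 st] : T1 <= T <= T2 by case/andP: Tin => *; rewrite !ltW.
have [w1 w2] := sided_outside Hj st.
have B1N := BN _ _ t0 w1; have B2N := BN _ _ t0 w2.
have nN := lt0r_neq0 (speed_gt0 k12 k1k2 t0 : 0 < nu T).
have JE : J T = df T * (nu T * B b2 T) / B b1 T.
  by rewrite /df; field; rewrite ?B1N ?B2N ?nN.
by move=> df0; exists T => //; rewrite JE df0 !mul0r.
Qed.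

Lemma closing_tangent T T' : closing T T' -> u T = tilt j1 j2 T' -> J T = 0.
Proof.
move=> C uE; have [_ L1 L2] := closing_sided C; case: C => _ T0' _ _.
by rewrite /J L1 L2 uE chord_tilt // subrr.
Qed.

(** This makes the second derivative of the displacement nonzero at a tangency. *)
Lemma closing_contact_neq T T' : closing T T' -> u T = tilt j1 j2 T' ->
  contact (u T) (k1 * T) (k2 * T) != contact (tilt j1 j2 T') (j1 * T') (j2 * T').
Proof.
move=> C uE; have [s L1 L2] := closing_sided C.
have T0 : 0 < T by case: C.
have [_] := dJ_sign Hk Hj T0 s (closing_tangent C uE) ab.
by rewrite -/(B b1 T) -/(B b2 T) -/(u T) L1 L2 -uE eq_sym.
Qed.

Lemma closing_le2 T1 T2 T3 T1' T2' T3' : closing T1 T1' -> closing T2 T2' ->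
  closing T3 T3' -> T1 < T2 -> T2 < T3 -> False.
Proof.
move=> C1 C2 C3 T12 T23.
have [t /andP[h1 h2] Jt] := closing_rolle C1 C2 T12.
have [s /andP[h3 h4] Js] := closing_rolle C2 C3 T23.
have T10 : 0 < T1 by case: C1.
have t0 := lt_trans T10 h1; have ts := lt_trans h2 h3.
have [s3 _ _] := closing_sided C3.
exact: (J_zero_unique Hk Hj t0 ts (sided_le Hk (lt_trans t0 ts) (ltW h4) s3) Jt Js ab).
Qed.

(** The tangency is itself a zero of [J]; a second intersection would add, by Rolle, a zero strictly
    between the two. *)
Lemma closing_tangent_unique T1 T2 T1' T2' : closing T1 T1' -> closing T2 T2' ->
  u T1 = tilt j1 j2 T1' -> T1 = T2.
Proof.
move=> C1 C2 uE; have J1 := closing_tangent C1 uE.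
have T10 : 0 < T1 by case: C1.
have T20 : 0 < T2 by case: C2.
have [s1 _ _] := closing_sided C1; have [s2 _ _] := closing_sided C2.
have [T12|T21|//] := ltgtP T1 T2; exfalso.
- have [t /andP[h1 h2] Jt] := closing_rolle C1 C2 T12.
  exact: (J_zero_unique Hk Hj T10 h1 (sided_le Hk (lt_trans T10 h1) (ltW h2) s2) J1 Jt ab).
- have [t /andP[h1 h2] Jt] := closing_rolle C2 C1 T21.
  exact: (J_zero_unique Hk Hj (lt_trans T20 h1) h2 s1 Jt J1 ab).
Qed.

End Cycles.

(** * The half-return as a function of the ordinate *)

Section ReturnMap.
Variable R : realType.
Implicit Types k a e T y z : R.

Lemma yent_scale k1 k2 a1 a2 e T :
  yent k1 k2 (e * a1) (e * a2) T = e * yent k1 k2 a1 a2 T.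
Proof. by rewrite /yent /zret; ring. Qed.

Lemma zret_scale k1 k2 a1 a2 e T :
  zret k1 k2 (e * a1) (e * a2) T = e * zret k1 k2 a1 a2 T.
Proof. by rewrite /zret; ring. Qed.

Variables k1 k2 a1 a2 e : R.
(* The sign of [e] orients the half-returns: [z - y] has the sign of [e]. *)
Hypothesis H : node_data k1 k2 (e * a1) (e * a2).

Let k12 : 0 < k1 * k2. Proof. by case: H. Qed.
Let k1k2 : k1 != k2. Proof. by case: H => _ h _; apply: contraTneq h => ->; rewrite ltxx. Qed.
Let Y := yent k1 k2 a1 a2.
Let Z := zret k1 k2 a1 a2.
Let u := tilt k1 k2.

Lemma gap_scale_gt0 T : 0 < T -> 0 < e * (Z T - Y T).
Proof.
by move=> T0; have := gap_gt0 H T0; rewrite yent_scale zret_scale -subr_gt0 -mulrBr.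
Qed.

Lemma yent_inj T T' : 0 < T -> 0 < T' -> Y T = Y T' -> T = T'.
Proof.
move=> T0 T0' E; have [h|h|//] := ltgtP T T'.
- by have := yent_lt H T0 h; rewrite !yent_scale -/Y E ltxx.
- by have := yent_lt H T0' h; rewrite !yent_scale -/Y E ltxx.
Qed.

Definition half_time y : R := inverse_on [set T | 0 < T] Y y.

Lemma half_timeK T : 0 < T -> half_time (Y T) = T.
Proof. by move=> T0; apply: inverse_onK => //; exact: yent_inj. Qed.

Let gapN T : 0 < T -> Z T - Y T != 0.
Proof. by move=> /gap_scale_gt0 h; apply: contraTneq h => ->; rewrite mulr0 ltxx. Qed.

Let dY T := - (Z T - Y T) / speed k1 k2 T.

Let dYN T : 0 < T -> dY T != 0.
Proof.
move=> T0; have s := lt0r_neq0 (speed_gt0 k12 k1k2 T0).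
by rewrite mulf_neq0 ?invr_eq0 // oppr_eq0 gapN.
Qed.

Lemma der_half_time T : 0 < T ->
  is_derive (Y T) 1 half_time (dY T)^-1 /\
  \forall y \near Y T, 0 < half_time y /\ Y (half_time y) = y.
Proof.
move=> T0; have oD : open [set T : R | 0 < T] by exact: open_gt.
have D z : [set T : R | 0 < T] z -> is_derive z 1 Y (dY z) by move=> z0; exact: der_yent.
exact: (local_inverse oD T0 D yent_inj (dYN T0)).
Qed.

Lemma der_return T : 0 < T ->
  is_derive (Y T) 1 (fun y => Z (half_time y)) (- u T).
Proof.
move=> T0; have [hd _] := der_half_time T0.
have hz : is_derive (half_time (Y T)) 1 Z (u T * (Z T - Y T) / speed k1 k2 T).
  by rewrite (half_timeK T0); apply: der_zret.
apply: (der_eq (der_comp hz hd)).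
have s := lt0r_neq0 (speed_gt0 k12 k1k2 T0); have g := gapN T0.
by rewrite /dY; field; rewrite ?s ?g.
Qed.

Lemma der_return_tilt T : 0 < T ->
  is_derive (Y T) 1 (fun y => u (half_time y))
    (contact (u T) (k1 * T) (k2 * T) / (Z T - Y T)).
Proof.
move=> T0; have [hd _] := der_half_time T0.
have hz : is_derive (half_time (Y T)) 1 u (- contact (u T) (k1 * T) (k2 * T) / speed k1 k2 T).
  by rewrite (half_timeK T0); apply: der_tilt.
apply: (der_eq (der_comp hz hd)).
have s := lt0r_neq0 (speed_gt0 k12 k1k2 T0); have g := gapN T0.
by rewrite /dY; field; rewrite ?s ?g.
Qed.

Lemma near_der_return T : 0 < T -> \forall y \near Y T,
  is_derive (y : R) 1 (fun y => Z (half_time y)) (- u (half_time y)).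
Proof.
move=> T0; have [_] := der_half_time T0; apply: filterS => y [h0 hy].
by have := der_return h0; rewrite hy.
Qed.

Lemma near_derivable_tilt T : 0 < T -> \forall y \near Y T,
  derivable (fun y => u (half_time y)) (y : R) 1.
Proof.
move=> T0; have [_] := der_half_time T0; apply: filterS => y [h0 hy].
by have := der_return_tilt h0; rewrite hy => -[].
Qed.

End ReturnMap.

(** * Simple and double zeros *)

Section Multiplicity.
Variable R : realType.
Implicit Types (f g : R -> R) (a c : R).

Lemma zero_of_multiplicity1 f a c : (\forall x \near a, derivable f (x : R) 1) -> f a = 0 ->
  is_derive a 1 f c -> c != 0 -> zero_of_multiplicity f a 1.
Proof.
move=> fd fa [_ fc] c0; split.
- by [].
- case=> [_|k kl]; [rewrite derive1n0; exact fd | exfalso; by rewrite ltnS ltn0 in kl].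
- case=> [_|k kl]; [exact: fa | exfalso; by rewrite ltnS ltn0 in kl].
- by rewrite derive1n1 derive1E fc.
Qed.

Lemma zero_of_multiplicity2 f g a c : (\forall x \near a, is_derive (x : R) 1 f (g x)) ->
  f a = 0 -> g a = 0 -> (\forall x \near a, derivable g (x : R) 1) ->
  is_derive a 1 g c -> c != 0 -> zero_of_multiplicity f a 2.
Proof.
move=> fg fa ga gd [_ gc] c0.
have fgE : \forall x \near a, g x = derive1 f x.
  by apply: filterS fg => x [_ fx]; rewrite derive1E fx.
split.
- by [].
- case=> [_|[_|k kl]]; last by exfalso; rewrite !ltnS ltn0 in kl.
    by apply: filterS fg => x [].
  rewrite derive1n1; have fgE' := near_join fgE.
  by apply: filterS2 gd fgE' => x gx E; exact: near_eq_derivable E gx.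
- case=> [_|[_|k kl]]; last by exfalso; rewrite !ltnS ltn0 in kl.
    exact: fa.
  by rewrite derive1n1 -(nbhs_singleton fgE).
- by rewrite derive1nS derive1n1 derive1E -(near_eq_derive _ fgE) gc.
Qed.

End Multiplicity.

(** * Arcs and orbits *)

Section Flow.
Variable R : realType.
Implicit Types (A : 'M[R]_2) (b : 'cV[R]_2) (y z t T l p c : R).

Lemma sum2 (F : 'I_2 -> R) : \sum_(i < 2) F i = F 0 + F 1.
Proof.
by rewrite big_ord_recl big_ord1; congr (_ + F _); apply: val_inj.
Qed.

Lemma ord2 (i : 'I_2) : i = 0 \/ i = 1.
Proof. by case: i => -[|[|//]] h; [left|right]; apply: val_inj. Qed.

Lemma affine_fieldE A b (p : 'cV[R]_2) (i : 'I_2) :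
  affine_field A b p i 0 = A i 0 * p 0 0 + A i 1 * p 1 0 + b i 0.
Proof. by rewrite /affine_field !mxE sum2. Qed.

Lemma is_solutionP A b (phi : R -> 'cV[R]_2) : is_solution A b phi <->
  forall (t : R) (i : 'I_2),
    is_derive t 1 (fun s => phi s i 0) (affine_field A b (phi t) i 0).
Proof.
split=> H t.
- move=> i; have [Hd HD] := H t.
  have Hi : derivable (fun s => phi s i 0) t 1 by move/derivable_mxP : Hd; apply.
  split; first exact Hi.
  by rewrite -HD (derive_mx Hd) mxE.
- have Hd : derivable phi t 1.
    apply/derivable_mxP => i j; rewrite (ord1 j); by case: (H t i).
  split; first exact Hd.
  apply/matrixP => i j; rewrite (derive_mx Hd) mxE (ord1 j).
  by case: (H t i).
Qed.

Lemma exp_ode (g : R -> R) l : (forall t : R, is_derive t 1 g (l * g t)) ->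
  forall t, g t = expR (l * t) * g 0.
Proof.
move=> H t.
have D (s : R) : is_derive s 1 (fun s => expR (- (l * s)) * g s) 0.
  have Hs := H s; der; ring.
have E := is_derive_0_is_cst t 0 D.
by rewrite mulr0 oppr0 expR0 mul1r in E; rewrite -E mulrA -expRD subrr expR0 mul1r.
Qed.

Lemma axis_ptE y : (axis_pt y) 0 0 = 0 /\ (axis_pt y) 1 0 = y.
Proof. by rewrite !mxE. Qed.

(* Linear coordinates [p_i x + y] diagonalizing the linear part; the value of
   the [i]-th one at the equilibrium is [c_i]. *)
Definition node_coords A b l1 l2 p1 p2 c1 c2 : Prop :=
  [/\ p1 * A 0 0 + A 1 0 = l1 * p1 /\ p1 * A 0 1 + A 1 1 = l1,
      p2 * A 0 0 + A 1 0 = l2 * p2 /\ p2 * A 0 1 + A 1 1 = l2,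
      p1 * b 0 0 + b 1 0 = - (l1 * c1) /\ p2 * b 0 0 + b 1 0 = - (l2 * c2),
      l1 != l2 & 0 < l1 * l2].

(** The solution starting at [(0, y)], where both coordinates [p_i x + y] equal [y]: [g1] and [g2]
    are their values at time [t], from which the point is recovered. *)
Definition flow l1 l2 p1 p2 c1 c2 y t : 'cV[R]_2 :=
  let g1 := expR (l1 * t) * (y - c1) + c1 in
  let g2 := expR (l2 * t) * (y - c2) + c2 in
  \col_(i < 2) (if i == 0 then (g1 - g2) / (p1 - p2)
                else (p1 * g2 - p2 * g1) / (p1 - p2)).

Section Coordinates.
Variables (A : 'M[R]_2) (b : 'cV[R]_2) (l1 l2 p1 p2 c1 c2 : R).
Hypothesis H : node_coords A b l1 l2 p1 p2 c1 c2.

Let phi := flow l1 l2 p1 p2 c1 c2.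

Let dE : (p1 - p2) * A 0 1 = l1 - l2.
Proof. by case: H => -[_ E1] [_ E2] _ _ _; rewrite -E1 -E2; ring. Qed.

Let dN : p1 - p2 != 0.
Proof.
case: H => _ _ _ l12 _; apply: contraNneq l12 => h.
by move: dE; rewrite h mul0r => /esym/eqP; rewrite subr_eq0.
Qed.

Let l1N : l1 != 0.
Proof. by case: H => _ _ _ _; apply: contraTneq => ->; rewrite mul0r ltxx. Qed.
Let l2N : l2 != 0.
Proof. by case: H => _ _ _ _; apply: contraTneq => ->; rewrite mulr0 ltxx. Qed.

Let flow0E y t : phi y t 0 0 =
  (expR (l1 * t) * (y - c1) + c1 - (expR (l2 * t) * (y - c2) + c2)) / (p1 - p2).
Proof. by rewrite mxE. Qed.

Let flow1E y t : phi y t 1 0 =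
  (p1 * (expR (l2 * t) * (y - c2) + c2) - p2 * (expR (l1 * t) * (y - c1) + c1)) / (p1 - p2).
Proof. by rewrite mxE. Qed.

Lemma solution_flow psi y : is_solution A b psi -> psi 0 = axis_pt y ->
  forall t, psi t = phi y t.
Proof.
move=> /is_solutionP S S0 t; case: (H) => -[E11 E12] [E21 E22] [B1 B2] _ _.
have [X0 Y0] := axis_ptE y.
have G1 (s : R) : is_derive s 1 (fun s => p1 * psi s 0 0 + psi s 1 0 - c1)
   (l1 * (p1 * psi s 0 0 + psi s 1 0 - c1)).
  have D0 := S s 0; have D1 := S s 1.
  apply: (der_eq (derD (derD (derM (der_cst p1 s) D0) D1) (der_cst (- c1) s))).
  rewrite !affine_fieldE; set x := psi s 0 0; set w := psi s 1 0.
  transitivity ((p1 * A 0 0 + A 1 0) * x + (p1 * A 0 1 + A 1 1) * w + (p1 * b 0 0 + b 1 0)); first by ring.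
  by rewrite E11 E12 B1; ring.
have G2 (s : R) : is_derive s 1 (fun s => p2 * psi s 0 0 + psi s 1 0 - c2)
   (l2 * (p2 * psi s 0 0 + psi s 1 0 - c2)).
  have D0 := S s 0; have D1 := S s 1.
  apply: (der_eq (derD (derD (derM (der_cst p2 s) D0) D1) (der_cst (- c2) s))).
  rewrite !affine_fieldE; set x := psi s 0 0; set w := psi s 1 0.
  transitivity ((p2 * A 0 0 + A 1 0) * x + (p2 * A 0 1 + A 1 1) * w + (p2 * b 0 0 + b 1 0)); first by ring.
  by rewrite E21 E22 B2; ring.
have F1 := exp_ode G1 t; have F2 := exp_ode G2 t.
rewrite S0 X0 Y0 mulr0 add0r in F1; rewrite S0 X0 Y0 mulr0 add0r in F2.
have {}F1 : expR (l1 * t) * (y - c1) = p1 * psi t 0 0 + psi t 1 0 - c1 by rewrite F1.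
have {}F2 : expR (l2 * t) * (y - c2) = p2 * psi t 0 0 + psi t 1 0 - c2 by rewrite F2.
apply/matrixP => i j; rewrite (ord1 j); case: (ord2 i) => ->.
- by rewrite flow0E F1 F2; field.
- by rewrite flow1E F1 F2; field.
Qed.

Lemma flow_solution y : is_solution A b (phi y).
Proof.
apply/is_solutionP => t i; case: (H) => -[E11 E12] [E21 E22] [B1 B2] _ _.
have D1 : is_derive t 1 (fun s => expR (l1 * s) * (y - c1) + c1)
     (l1 * (expR (l1 * t) * (y - c1))) by der; ring.
have D2 : is_derive t 1 (fun s => expR (l2 * s) * (y - c2) + c2)
     (l2 * (expR (l2 * t) * (y - c2))) by der; ring.
have a00 : A 0 0 = (l1 * p1 - l2 * p2) / (p1 - p2).
  by apply: (mulIf dN); rewrite divfK // -E11 -E21; ring.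
have a10 : A 1 0 = l1 * p1 - p1 * A 0 0 by rewrite -E11; ring.
have a01 : A 0 1 = (l1 - l2) / (p1 - p2).
  by apply: (mulIf dN); rewrite divfK // -E12 -E22; ring.
have a11 : A 1 1 = l1 - p1 * A 0 1 by rewrite -E12; ring.
have b0 : b 0 0 = (l2 * c2 - l1 * c1) / (p1 - p2).
  apply: (mulIf dN); rewrite divfK // -[l2 * c2]opprK -B2 -[l1 * c1]opprK -B1; ring.
have b1 : b 1 0 = - (l1 * c1) - p1 * b 0 0 by rewrite -B1; ring.
case: (ord2 i) => ->.
- have E : (fun s => phi y s 0 0) = (fun s => ((expR (l1 * s) * (y - c1) + c1) -
     (expR (l2 * s) * (y - c2) + c2)) * (p1 - p2)^-1) by apply/funext => s; rewrite flow0E.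
  rewrite E; apply: (der_eq (derM (derD D1 (derN D2)) (der_cst _ t))).
  rewrite affine_fieldE flow0E flow1E a00 a01 b0.
  by field; rewrite ?mulN1r.
- have E : (fun s => phi y s 1 0) = (fun s => (p1 * (expR (l2 * s) * (y - c2) + c2) -
     p2 * (expR (l1 * s) * (y - c1) + c1)) * (p1 - p2)^-1) by apply/funext => s; rewrite flow1E.
  rewrite E.
  apply: (der_eq (derM (derD (derM (der_cst p1 t) D2) (derN (derM (der_cst p2 t) D1))) (der_cst _ t))).
  rewrite affine_fieldE flow0E flow1E a10 a11 b1 a00 a01 b0.
  by field; rewrite ?mulN1r.
Qed.

Lemma flow_start y : phi y 0 = axis_pt y.
Proof.
have [X0 Y0] := axis_ptE y.
apply/matrixP => i j; rewrite (ord1 j); case: (ord2 i) => ->.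
- by rewrite flow0E X0 !mulr0 expR0; field.
- by rewrite flow1E Y0 !mulr0 expR0; field.
Qed.

Lemma flow_axisP y z T : phi y T = axis_pt z <->
  z - c1 = expR (l1 * T) * (y - c1) /\ z - c2 = expR (l2 * T) * (y - c2).
Proof.
have [X0 Y0] := axis_ptE z; split.
- move=> E; have E0 := flow0E y T; have E1 := flow1E y T.
  rewrite E X0 in E0; rewrite E Y0 in E1.
  move: E0 E1; set g1 := expR (l1 * T) * (y - c1); set g2 := expR (l2 * T) * (y - c2) => E0 E1.
  have {}E0 : g2 + c2 = g1 + c1.
    have : 0 * (p1 - p2) = g1 + c1 - (g2 + c2) by rewrite E0 divfK.
    by rewrite mul0r => /esym/eqP; rewrite subr_eq0 => /eqP.
  have {}E1 : z = g1 + c1 by rewrite E1 E0; field.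
  by split; [rewrite E1|rewrite E1 -E0]; ring.
- move=> [E1 E2]; apply/matrixP => i j; rewrite (ord1 j); case: (ord2 i) => ->.
  + by rewrite flow0E X0 -E1 -E2; field.
  + by rewrite flow1E Y0 -E1 -E2; field.
Qed.

Lemma field_axis y : (p1 - p2) * affine_field A b (axis_pt y) 0 0 =
  l1 * (y - c1) - l2 * (y - c2).
Proof.
case: (H) => -[E11 E12] [E21 E22] [B1 B2] _ _; have [X0 Y0] := axis_ptE y.
rewrite affine_fieldE X0 Y0 !mulrBr -[l1 * c1]opprK -B1 -[l2 * c2]opprK -B2.
by rewrite -{1}E12 -{1}E22; ring.
Qed.

(** Up to a positive factor, the quantity in the first clause is a function [f] vanishing at 0 and
    [T], with derivative [u t * exp (l2 t)] where [u] is strictly increasing. So [f'] changes sign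
    once, from negative to positive; this gives the sign inside and transversality at both ends.
    Hence the side of an arc, and the crossing conditions, are read off from its endpoints. *)
Lemma flow_sign y z T : 0 < T -> y != z ->
  z - c1 = expR (l1 * T) * (y - c1) -> z - c2 = expR (l2 * T) * (y - c2) ->
  [/\ forall t, 0 < t < T -> A 0 1 * (z - y) * phi y t 0 0 < 0,
      A 0 1 * (z - y) * affine_field A b (axis_pt y) 0 0 < 0 &
      0 < A 0 1 * (z - y) * affine_field A b (axis_pt z) 0 0].
Proof.
move=> T0 yz E1 E2.
have zyE : z - y = (expR (l1 * T) - 1) * (y - c1) by rewrite mulrBl -E1; ring.
have yN : y - c1 != 0.
  apply: contraNneq yz => h; move/eqP: zyE.
  by rewrite h mulr0 subr_eq0 eq_sym.
have q0 : 0 < (z - y) * (l1 * (y - c1)).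
  have e : 0 < l1 * (expR (l1 * T) - 1).
    have [l0|l0|l0] := ltgtP l1 0; last by have := l1N; rewrite l0 eqxx.
    - by rewrite nmulr_rgt0 // subr_lt0 expR_lt1 pmulr_llt0.
    - by rewrite mulr_gt0 // subr_gt0 expR_gt1 mulr_gt0.
  have -> : (z - y) * (l1 * (y - c1)) = l1 * (expR (l1 * T) - 1) * (y - c1) ^+ 2.
    by rewrite zyE; ring.
  by rewrite mulr_gt0 // exprn_even_gt0.
have l12 : 0 < (l1 - l2) ^+ 2.
  by rewrite exprn_even_gt0 //= subr_eq0; case: H.
pose k := (z - y) * (l1 - l2).
pose f t := k * ((expR (l1 * t) * (y - c1) + c1) - (expR (l2 * t) * (y - c2) + c2)).
pose u t := k * (l1 * (y - c1) * expR ((l1 - l2) * t) - l2 * (y - c2)).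
have fD (t : R) : is_derive t 1 f (u t * expR (l2 * t)).
  have e : expR (l1 * t) = expR ((l1 - l2) * t) * expR (l2 * t).
    by rewrite -expRD; congr expR; ring.
  by rewrite /f; der; rewrite /u e; ring.
have uD (t : R) : is_derive t 1 u
   ((l1 - l2) ^+ 2 * ((z - y) * (l1 * (y - c1))) * expR ((l1 - l2) * t)).
  by rewrite /u; der; rewrite /k; ring.
have u_lt s t : s < t -> u s < u t.
  move=> st; apply: (der_increasing st (fun t _ => uD t)) => x _.
  by apply: mulr_gt0; [apply: mulr_gt0|exact: expR_gt0].
have f0 : f 0 = 0 by rewrite /f !mulr0 expR0; ring.
have fT : f T = 0 by rewrite /f -E1 -E2; ring.
have [x /andP[x0 xT]] := rolle T0 (fun t _ => fD t) (etrans f0 (esym fT)).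
move=> /eqP; rewrite mulf_eq0 (gt_eqF (expR_gt0 _)) orbF => /eqP ux.
have f_lt0 t : 0 < t < T -> f t < 0.
  move=> /andP[t0 tT]; have [tx|xt] := leP t x.
  - rewrite -f0 -ltrN2.
    apply: (der_increasing t0 (fun t _ => derN (fD t))) => s /andP[_ st].
    rewrite oppr_gt0 pmulr_llt0 ?expR_gt0 // -ux; exact/u_lt/(lt_le_trans st).
  - rewrite -fT; apply: (der_increasing tT (fun t _ => fD t)) => s /andP[ts _].
    apply: mulr_gt0; last exact: expR_gt0.
    by rewrite -ux; exact/u_lt/(lt_trans xt).
have d2 : 0 < (p1 - p2) ^+ 2 by rewrite exprn_even_gt0.
have kE : A 0 1 * (z - y) = k / (p1 - p2).
  by apply: (mulIf dN); rewrite divfK // /k -dE; ring.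
split.
- move=> t /f_lt0 ft; rewrite kE flow0E.
  rewrite (_ : _ * _ = f t / (p1 - p2) ^+ 2); last by rewrite /f; field.
  by rewrite pmulr_llt0 // invr_gt0.
- rewrite kE (_ : _ * _ = k * ((p1 - p2) * affine_field A b (axis_pt y) 0 0) / (p1 - p2) ^+ 2).
    rewrite field_axis pmulr_llt0 ?invr_gt0 //.
    by have := u_lt 0 x x0; rewrite ux /u mulr0 expR0 mulr1.
  by field.
- rewrite kE (_ : _ * _ = k * ((p1 - p2) * affine_field A b (axis_pt z) 0 0) / (p1 - p2) ^+ 2).
    rewrite field_axis; apply: divr_gt0 => //.
    have := u_lt x T xT; rewrite ux E1 E2 => uT.
    have e : expR (l1 * T) = expR ((l1 - l2) * T) * expR (l2 * T).
      by rewrite -expRD; congr expR; ring.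
    have -> : k * (l1 * (expR (l1 * T) * (y - c1)) - l2 * (expR (l2 * T) * (y - c2)))
       = u T * expR (l2 * T) by rewrite e /u; ring.
    exact: mulr_gt0 uT (expR_gt0 _).
  by field.
Qed.

(** With nonzero rates, a return to the starting point forces [c1 = c2 = y]: the solution is an
    equilibrium on the axis. *)
Lemma no_return_gap y z T psi (D : set 'cV[R]_2) : is_arc D A b y z T psi ->
  (forall p : 'cV[R]_2, D p -> p 0 0 != 0) -> y != z.
Proof.
move=> [S T0 S0 ST ST'] HD; apply/eqP => yz.
have E := solution_flow S S0.
have /flow_axisP[E1 E2] : phi y T = axis_pt z by rewrite -E.
rewrite -yz in E1 E2.
have c l c : l != 0 -> y - c = expR (l * T) * (y - c) -> y - c = 0.
  move=> lN h; apply/eqP; have : (expR (l * T) - 1) * (y - c) = 0.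
    by rewrite mulrBl -h; ring.
  move=> /eqP; rewrite mulf_eq0 subr_eq0 => /orP[|//].
  by rewrite -(expR0 R) (inj_eq (@expR_inj R)) mulf_eq0 (negPf lN) (gt_eqF T0).
have Th : 0 < T / 2 < T by apply/andP; split; lra.
have := HD _ (ST' _ Th); rewrite E flow0E.
have y1 := c _ _ l1N E1; have y2 := c _ _ l2N E2.
rewrite y1 y2 !mulr0 !add0r => /negP; apply.
have -> : c1 = c2 by have := subr_eq0 y c1; have := subr_eq0 y c2; rewrite y1 y2 eqxx => /esym/eqP <- /esym/eqP.
by rewrite subrr mul0r.
Qed.

Lemma left_arcP y z T psi : is_arc (@left_plane R) A b y z T psi <->
  [/\ 0 < T, z - c1 = expR (l1 * T) * (y - c1),
      z - c2 = expR (l2 * T) * (y - c2), 0 < A 0 1 * (z - y) & psi = phi y].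
Proof.
split.
- move=> arc; have yz : y != z.
    by apply: (no_return_gap arc) => p /= h; rewrite lt_eqF.
  case: (arc) => S T0 S0 ST ST'.
  have E := solution_flow S S0.
  have /flow_axisP[E1 E2] : phi y T = axis_pt z by rewrite -E.
  have [F _ _] := flow_sign T0 yz E1 E2.
  split=> //; last exact/funext.
  have Th : 0 < T / 2 < T by apply/andP; split; lra.
  have := F _ Th; have := ST' _ Th; rewrite /left_plane /= /xcoord E => h.
  by rewrite nmulr_llt0.
- move=> [T0 E1 E2 zy ->].
  have yz : y != z by apply: contraTneq zy => ->; rewrite subrr mulr0 ltxx.
  have [F _ _] := flow_sign T0 yz E1 E2.
  split=> //; [exact: flow_solution | exact: flow_start | exact/flow_axisP |].
  by move=> t /F; rewrite pmulr_rlt0.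
Qed.

Lemma right_arcP y z T psi : is_arc (@right_plane R) A b y z T psi <->
  [/\ 0 < T, z - c1 = expR (l1 * T) * (y - c1),
      z - c2 = expR (l2 * T) * (y - c2), A 0 1 * (z - y) < 0 & psi = phi y].
Proof.
split.
- move=> arc; have yz : y != z.
    by apply: (no_return_gap arc) => p /= h; rewrite gt_eqF.
  case: (arc) => S T0 S0 ST ST'.
  have E := solution_flow S S0.
  have /flow_axisP[E1 E2] : phi y T = axis_pt z by rewrite -E.
  have [F _ _] := flow_sign T0 yz E1 E2.
  split=> //; last exact/funext.
  have Th : 0 < T / 2 < T by apply/andP; split; lra.
  have := F _ Th; have := ST' _ Th; rewrite /right_plane /= /xcoord E => h.
  by rewrite pmulr_llt0.
- move=> [T0 E1 E2 zy ->].
  have yz : y != z by apply: contraTneq zy => ->; rewrite subrr mulr0 ltxx.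
  have [F _ _] := flow_sign T0 yz E1 E2.
  split=> //; [exact: flow_solution | exact: flow_start | exact/flow_axisP |].
  by move=> t /F; rewrite nmulr_rlt0.
Qed.

End Coordinates.

End Flow.

(** * Existence of the diagonalizing coordinates and orientation of the half-returns *)

Section Coordinates.
Variable R : realType.
Implicit Types (A : 'M[R]_2) (b : 'cV[R]_2) (y z t T k l p c a e : R).

(** The coordinates are left eigenvectors scaled to second entry 1, an entry that is nonzero because
    [A 0 1] is. Distinct eigenvalues of the same sign have distinct squares, so they can be
    ordered. *)
Lemma node_coords_exist A b : node_type A -> A 0 1 != 0 ->
  exists l1 l2 p1 p2 c1 c2, node_coords A b l1 l2 p1 p2 c1 c2 /\ l2 ^+ 2 < l1 ^+ 2.
Proof.
move=> [m1 [m2 [E1 E2 m12 m0]]] AN.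
have coord l : eigenvalue A l ->
    exists p, p * A 0 0 + A 1 0 = l * p /\ p * A 0 1 + A 1 1 = l.
  move=> /eigenvalueP[v vA vN].
  have ve j : v 0 0 * A 0 j + v 0 1 * A 1 j = l * v 0 j.
    by have := congr1 (fun w : 'rV_2 => w 0 j) vA; rewrite !mxE sum2.
  have v1N : v 0 1 != 0.
    apply: contraNneq vN => v1; apply/eqP/matrixP => i j; rewrite (ord1 i) mxE.
    have v0 : v 0 0 = 0.
      have := ve 1; rewrite v1 mul0r mulr0 addr0 => /eqP.
      by rewrite mulf_eq0 (negPf AN) orbF => /eqP.
    by case: (ord2 j) => ->.
  exists (v 0 0 / v 0 1); split; apply: (mulIf v1N).
    by rewrite -[RHS]mulrA divfK // -ve; field.
  by rewrite -ve; field.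
have mk m1' m2' : eigenvalue A m1' -> eigenvalue A m2' -> m1' != m2' ->
    0 < m1' * m2' -> m2' ^+ 2 < m1' ^+ 2 ->
    exists l1 l2 p1 p2 c1 c2, node_coords A b l1 l2 p1 p2 c1 c2 /\ l2 ^+ 2 < l1 ^+ 2.
  move=> e1 e2 mm mp mlt; have [p1 P1] := coord _ e1; have [p2 P2] := coord _ e2.
  have n1 : m1' != 0 by apply: contraTneq mp => ->; rewrite mul0r ltxx.
  have n2 : m2' != 0 by apply: contraTneq mp => ->; rewrite mulr0 ltxx.
  exists m1', m2', p1, p2, (- (p1 * b 0 0 + b 1 0) / m1'), (- (p2 * b 0 0 + b 1 0) / m2').
  by split=> //; split=> //; split; field.
have [lt21|lt12|E] := ltgtP (m2 ^+ 2) (m1 ^+ 2).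
- exact: (mk m1 m2).
- by apply: (mk m2 m1) => //; [rewrite eq_sym | rewrite mulrC].
- move/eqP: E; rewrite eqf_sqr eq_sym (negPf m12) /= => /eqP E.
  by move: m0; rewrite E mulrN oppr_gt0 ltNge -expr2 sqr_ge0.
Qed.

(** Here [x] obeys a scalar affine equation. Two zeros of [x] give a zero of [x'], which is a
    multiple of an exponential, so [x] is identically 0. *)
Lemma no_arc A b (D : set 'cV[R]_2) y z T psi : A 0 1 = 0 ->
  (forall p : 'cV[R]_2, D p -> p 0 0 != 0) -> ~ is_arc D A b y z T psi.
Proof.
move=> A0 HD [/is_solutionP S T0 S0 ST ST'].
pose x t := psi t 0 0; pose w t := A 0 0 * x t + b 0 0.
have xD (t : R) : is_derive t 1 x (w t).
  by apply: (der_eq (S t 0)); rewrite affine_fieldE A0 mul0r addr0.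
have x0 : x 0 = 0 by rewrite /x S0 (axis_ptE y).1.
have xT : x T = 0 by rewrite /x ST (axis_ptE z).1.
have wD (t : R) : is_derive t 1 w (A 0 0 * w t).
  by apply: (der_eq (derD (derM (der_cst (A 0 0) t) (xD t)) (der_cst (b 0 0) t))); ring.
have wE := exp_ode wD.
have [s _ ws] := rolle T0 (fun t _ => xD t) (etrans x0 (esym xT)).
have w0 : w 0 = 0.
  by move: ws; rewrite wE => /eqP; rewrite mulf_eq0 (gt_eqF (expR_gt0 _)) => /eqP.
have xD0 (t : R) : is_derive t 1 x 0 by apply: (der_eq (xD t)); rewrite wE w0 mulr0.
have Th : 0 < T / 2 < T by apply/andP; split; lra.
have := HD _ (ST' _ Th); rewrite -/(x (T / 2)) (is_derive_0_is_cst (T / 2) 0 xD0) x0.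
by rewrite eqxx.
Qed.

Lemma node_data_of_pair k1 k2 a1 a2 e y z T : 0 < k1 * k2 -> k2 ^+ 2 < k1 ^+ 2 ->
  0 < T -> y - a1 = expR (k1 * T) * (z - a1) -> y - a2 = expR (k2 * T) * (z - a2) ->
  0 < e * (z - y) -> node_data k1 k2 (e * a1) (e * a2).
Proof.
move=> k12 kk T0 E1 E2 ezy; have k1k2 : k1 != k2.
  by apply: contraTneq kk => ->; rewrite ltxx.
have [yE zE] := zret_unique k1k2 (lt0r_neq0 T0) E1 E2.
split=> //; have [h|aE] := gap_sign a1 a2 k12 k1k2 T0.
  rewrite -zE -yE in h.
  have d0 : 0 < (z - y) ^+ 2.
    by rewrite exprn_even_gt0 //=; apply: contraTneq ezy => ->; rewrite mulr0 ltxx.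
  rewrite -(pmulr_lgt0 _ d0).
  have -> : (e * a2 - e * a1) * (k1 - k2) * (z - y) ^+ 2 =
    e * (z - y) * ((a2 - a1) * (k1 - k2) * (z - y)) by ring.
  exact: mulr_gt0.
exfalso; have : z - y = 0 by rewrite zE yE gapE ?lt0r_neq0 // aE subrr mul0r oppr0 mul0r.
by move=> h; move: ezy; rewrite h mulr0 ltxx.
Qed.

Lemma zero_of_multiplicity_near (f g : R -> R) a m : (\forall x \near a, f x = g x) ->
  zero_of_multiplicity f a m -> zero_of_multiplicity g a m.
Proof.
move=> fg [m0 fd f0 fm].
have E n : \forall x \near a, derive1n n f x = derive1n n g x.
  elim: n => [|n IH]; first exact: fg.
  have := near_join IH; apply: filterS => x h.
  by rewrite !derive1nS !derive1E; exact: near_eq_derive.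
split.
- exact: m0.
- move=> n nm; have h := fd n nm; have h2 := near_join (E n).
  apply: filterS2 h h2 => x hx hx2; exact: near_eq_derivable hx2 hx.
- by move=> n nm; rewrite -(nbhs_singleton (E n)) f0.
- by rewrite -(nbhs_singleton (E m)).
Qed.

End Coordinates.

(** * Continuity of the arcs with respect to the time of return *)

Section FlowContinuity.
Variable R : realType.

Lemma cvg_mx_entries (X : Type) (F : set_system X) m n (f : X -> 'M[R]_(m, n))
    (M : 'M[R]_(m, n)) : Filter F ->
  (forall i j, (fun x => f x i j) @ F --> M i j) -> f @ F --> M.
Proof.
move=> FF H A [P PM PA].
have h : \forall x \near F, forall i j, P i j (f x i j).
  apply: filter_forall => i; apply: filter_forall => j; exact: (H i j _ (PM i j)).
by apply: filterS h => x Px; apply: PA.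
Qed.

Lemma flow_cvg (X : Type) (F : set_system X) (f g : X -> R) l1 l2 p1 p2 c1 c2 y t :
  Filter F -> f @ F --> y -> g @ F --> t ->
  (fun x => flow l1 l2 p1 p2 c1 c2 (f x) (g x)) @ F --> flow l1 l2 p1 p2 c1 c2 y t.
Proof.
move=> FF Hf Hg.
have E (l c : R) : (fun x => expR (l * g x) * (f x - c) + c) @ F --> expR (l * t) * (y - c) + c.
  apply: cvgD; last exact: cvg_cst.
  apply: cvgM; last by apply: cvgB => //; exact: cvg_cst.
  apply: continuous_cvg; first exact: continuous_expR.
  by apply: cvgM => //; exact: cvg_cst.
apply: cvg_mx_entries => i j.
under eq_fun do rewrite mxE.
rewrite mxE; case: (i == 0).
- by apply: cvgM; [apply: cvgB; exact: E | exact: cvg_cst].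
- apply: cvgM; last exact: cvg_cst.
  by apply: cvgB; apply: cvgM; try exact: E; exact: cvg_cst.
Qed.

Lemma flow_near (U : set 'cV[R]_2) (f : R -> R) l1 l2 p1 p2 c1 c2 (T c : R) :
  open U -> f x @[x --> T] --> f T ->
  (forall s, 0 <= s <= 1 -> U (flow l1 l2 p1 p2 c1 c2 (f T) (s * (c * T)))) ->
  \forall T1 \near T, forall s, 0 <= s <= 1 ->
    U (flow l1 l2 p1 p2 c1 c2 (f T1) (s * (c * T1))).
Proof.
move=> oU fT H.
have cover := (compact_near_coveringP `[0, 1 : R]%classic).1 (@segment_compact R 0 1).
have N := cover R (nbhs T) (fun T1 s => U (flow l1 l2 p1 p2 c1 c2 (f T1) (s * (c * T1))))
  (nbhs_filter T).
apply: (filterS _ (N _)).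
- by move=> T1 h s s01; apply: h; rewrite /= in_itv.
- move=> s; rewrite /= in_itv /= => s01.
  have F : (fun x : R * R => flow l1 l2 p1 p2 c1 c2 (f x.2) (x.1 * (c * x.2))) @
      filter_prod (nbhs s) (nbhs T) --> flow l1 l2 p1 p2 c1 c2 (f T) (s * (c * T)).
    apply: flow_cvg.
    + by apply: cvg_comp fT; exact: cvg_snd.
    + apply: cvgM; first exact: cvg_fst.
      by apply: cvgM; [exact: cvg_cst | exact: cvg_snd].
  have UN : nbhs (flow l1 l2 p1 p2 c1 c2 (f T) (s * (c * T))) U.
    by apply: open_nbhs_nbhs; split=> //; apply: H.
  exact: (F U UN).
Qed.

End FlowContinuity.

(** * From intersections of curves to limit cycles *)

Definition cycles_bound (R : realType) (S : pwl_system R) : Prop :=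
  exists (cycles : seq (set 'cV[R]_2)) (mult : set 'cV[R]_2 -> nat),
    [/\ uniq cycles,
        forall Gamma : set 'cV[R]_2, Gamma \in cycles <-> limit_cycle S Gamma,
        forall Gamma : set 'cV[R]_2,
          limit_cycle S Gamma -> has_multiplicity S Gamma (mult Gamma) &
        (\sum_(Gamma <- cycles) mult Gamma <= 2)%N].

(** The candidates are filtered classically, so an orbit in the list never has to be proved
    isolated. *)
Lemma cycles_boundP (R : realType) (S : pwl_system R) (candidates : seq (set 'cV[R]_2))
    (mult : set 'cV[R]_2 -> nat) :
  (forall Gamma, limit_cycle S Gamma -> Gamma \in candidates) ->
  (forall Gamma, limit_cycle S Gamma -> has_multiplicity S Gamma (mult Gamma)) ->
  (\sum_(Gamma <- undup candidates) mult Gamma <= 2)%N -> cycles_bound S.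
Proof.
move=> cand multP le2; exists [seq Gamma <- undup candidates | `[< limit_cycle S Gamma >]], mult.
split=> //; first exact: filter_uniq (undup_uniq _).
- move=> Gamma; rewrite mem_filter mem_undup; split; first by case/andP => /asboolP.
  by move=> lc; rewrite cand // andbT; apply/asboolP.
- by apply: leq_trans le2; rewrite big_filter [leqRHS](bigID (fun Gamma => `[< limit_cycle S Gamma >])) leq_addr.
Qed.

Section Orbits.
Variable R : realType.
Variable S : pwl_system R.
Variables l1 l2 p1 p2 a1 a2 r1 r2 q1 q2 b1 b2 : R.
Hypothesis HL : node_coords (AL S) (bL S) l1 l2 p1 p2 a1 a2.
Hypothesis HR : node_coords (AR S) (bR S) r1 r2 q1 q2 b1 b2.
(** The sign of [e] is the orientation: left arcs satisfy [0 < e * (z - y)]. The right arc goes from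
    [z] to [y]; reading the left one backwards, with rates [- l_i], puts both in the form
    [y - c = exp (k T) (z - c)]. *)
Let e := AL S 0 1.
Hypothesis Hk : node_data (- l1) (- l2) (e * a1) (e * a2).
Hypothesis Hj : node_data r1 r2 (e * b1) (e * b2).
Hypothesis He : 0 < AL S 0 1 * AR S 0 1.
Implicit Types (y z t T : R) (Gamma : set 'cV[R]_2).

Let Y := yent (- l1) (- l2) a1 a2.
Let Z := zret (- l1) (- l2) a1 a2.
Let Yr := yent r1 r2 b1 b2.
Let Zr := zret r1 r2 b1 b2.
Let flowL := flow l1 l2 p1 p2 a1 a2.
Let flowR := flow r1 r2 q1 q2 b1 b2.

Let eN : e != 0.
Proof. by apply: contraTneq He => h; rewrite -/e h mul0r ltxx. Qed.
Let k12 : 0 < - l1 * - l2. Proof. by case: Hk. Qed.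
Let k1k2 : - l1 != - l2.
Proof. by case: Hk => _ h _; apply: contraTneq h => ->; rewrite ltxx. Qed.
Let j12 : 0 < r1 * r2. Proof. by case: Hj. Qed.
Let j1j2 : r1 != r2.
Proof. by case: Hj => _ h _; apply: contraTneq h => ->; rewrite ltxx. Qed.

Let rel_rev l y z T c : z - c = expR (l * T) * (y - c) <-> y - c = expR (- l * T) * (z - c).
Proof.
split=> ->; first by rewrite mulrA mulNr -expRD addNr expR0 mul1r.
by rewrite mulrA mulNr -expRD subrr expR0 mul1r.
Qed.

Let e_sign x : (0 < e * x) = (0 < AR S 0 1 * x).
Proof.
have [h|h|h] := ltgtP e 0; last by have := eN; rewrite h eqxx.
- have h' : AR S 0 1 < 0 by rewrite -(nmulr_rgt0 _ h).
  by rewrite !nmulr_rgt0.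
- have h' : 0 < AR S 0 1 by rewrite -(pmulr_rgt0 _ h).
  by rewrite !pmulr_rgt0.
Qed.

Lemma left_arc_param y z T psi : Defs.left_arc S y z T psi <->
  [/\ 0 < T, y = Y T, z = Z T & psi = flowL y].
Proof.
split.
- move=> /(left_arcP HL)[T0 /rel_rev E1 /rel_rev E2 ezy psiE].
  by have [yE zE] := zret_unique k1k2 (lt0r_neq0 T0) E1 E2.
- move=> [T0 yE zE psiE]; apply/(left_arcP HL); rewrite yE zE; have TN := lt0r_neq0 T0.
  split; [by []| | | |by rewrite psiE yE].
  + by apply/rel_rev; apply: zret_rel1.
  + by apply/rel_rev; apply: zret_rel2.
  + exact: (gap_scale_gt0 Hk T0).
Qed.

Lemma right_arc_param y z T psi : Defs.right_arc S z y T psi <->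
  [/\ 0 < T, y = Yr T, z = Zr T & psi = flowR z].
Proof.
split.
- move=> /(right_arcP HR)[T0 E1 E2 ezy psiE].
  by have [yE zE] := zret_unique j1j2 (lt0r_neq0 T0) E1 E2.
- move=> [T0 yE zE psiE]; apply/(right_arcP HR); rewrite yE zE; have TN := lt0r_neq0 T0.
  split; [by []| | | |by rewrite psiE zE].
  + exact: zret_rel1.
  + exact: zret_rel2.
  + by rewrite -opprB mulrN oppr_lt0 -e_sign; exact: (gap_scale_gt0 Hj T0).
Qed.

Let closingS := closing (- l1) (- l2) (e * a1) (e * a2) r1 r2 (e * b1) (e * b2).

Lemma closingE T T' : closingS T T' <-> [/\ 0 < T, 0 < T', Y T = Yr T' & Z T = Zr T'].
Proof.
have cancel x c w : e * x - e * c = expR w * (e * (Z T) - e * c) <->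
    x - c = expR w * (Z T - c).
  rewrite -!mulrBr mulrCA; split=> [/(mulfI eN)|->] //.
split=> [[T0 T0']|[T0 T0' EY EZ]]; rewrite ?yent_scale ?zret_scale.
- move=> /cancel E1 /cancel E2.
  by have [? ?] := zret_unique j1j2 (lt0r_neq0 T0') E1 E2.
- split=> //; rewrite yent_scale zret_scale; apply/cancel; rewrite -/Y EY EZ.
  + by apply: zret_rel1; rewrite ?lt0r_neq0.
  + by apply: zret_rel2; rewrite ?lt0r_neq0.
Qed.

Lemma closing_time_unique T T' T'' : closingS T T' -> closingS T T'' -> T' = T''.
Proof.
move=> /closingE[_ T0' E _] /closingE[_ T0'' E' _].
by apply: (yent_inj Hj T0' T0''); rewrite -/Yr -E -E'.
Qed.

Definition orbit T T' : set 'cV[R]_2 :=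
  flowL (Y T) @` [set t | 0 <= t <= T] `|` flowR (Z T) @` [set t | 0 <= t <= T'].

(** The crossing conditions follow from [flow_sign] on both sides, since [AL S 0 1] and [AR S 0 1]
    have the same sign. *)
Lemma orbitP y Gamma : crossing_orbit_entering_left_at S y Gamma <->
  exists T T', [/\ closingS T T', y = Y T & Gamma = orbit T T'].
Proof.
split.
- move=> [z [T [T' [phi [psi [/left_arc_param[T0 yE zE ->] /right_arc_param[T0' yE' zE' ->] _ _ ->]]]]]].
  exists T, T'; split=> //; first by apply/closingE; rewrite -yE -yE' -zE -zE'.
  by rewrite /orbit -yE -zE.
- move=> [T [T' [/closingE[T0 T0' EY EZ] yE ->]]].
  have arcL : Defs.left_arc S y (Z T) T (flowL y) by apply/left_arc_param.
  have arcR : Defs.right_arc S (Z T) y T' (flowR (Z T)).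
    by apply/right_arc_param; rewrite yE EY EZ.
  have ezy : 0 < e * (Z T - y) by rewrite yE; exact: (gap_scale_gt0 Hk T0).
  have yz : y != Z T by apply: contraTneq ezy => ->; rewrite subrr mulr0 ltxx.
  have [_ E1 E2 _ _] := (left_arcP HL y (Z T) T (flowL y)).1 arcL.
  have [_ F1 F2] := flow_sign HL T0 yz E1 E2.
  have [_ E1' E2' ezy' _] := (right_arcP HR (Z T) y T' (flowR (Z T))).1 arcR.
  rewrite eq_sym in yz; have [_ F1' F2'] := flow_sign HR T0' yz E1' E2'.
  exists (Z T), T, T', (flowL y), (flowR (Z T)); split=> //; last by rewrite yE.
  + rewrite /crossing_at /xcoord; move: F1 F2'; rewrite -/e pmulr_rlt0 // nmulr_rgt0 //.
    by move=> h1 h2; rewrite nmulr_rgt0.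
  + rewrite /crossing_at /xcoord; move: F2 F1'; rewrite -/e pmulr_rgt0 // nmulr_rlt0 //.
    by move=> h1 h2; rewrite mulr_gt0.
Qed.

Lemma P_L_return T : 0 < T -> P_L S (Y T) = Z T.
Proof.
move=> T0; rewrite /P_L; set D := [set z | _].
have DZ : D (Z T) by exists T, (flowL (Y T)); apply/left_arc_param.
have [T' [phi /left_arc_param[T0' EY -> _]]] : D (xget 0 D) by apply: xgetPex; exists (Z T).
by rewrite (yent_inj Hk T0 T0' EY).
Qed.

Lemma P_R_inv_return T : 0 < T -> P_R_inv S (Yr T) = Zr T.
Proof.
move=> T0; rewrite /P_R_inv; set D := [set z | _].
have DZ : D (Zr T) by exists T, (flowR (Zr T)); apply/right_arc_param.
have [T' [phi /right_arc_param[T0' EY -> _]]] : D (xget 0 D) by apply: xgetPex; exists (Zr T).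
by rewrite (yent_inj Hj T0 T0' EY).
Qed.

(** Near [Y T] the displacement is a difference of returns expressed through the half-times. Its
    derivative is the difference of the tilts; when these agree, the second derivative is a nonzero
    difference of contacts divided by the gap. *)
Lemma displacement_multiplicity T T' : closingS T T' ->
  ~ (e * a1 = e * b1 /\ e * a2 = e * b2) ->
  zero_of_multiplicity (displacement S) (Y T)
    (if tilt (- l1) (- l2) T == tilt r1 r2 T' then 2 else 1)%N.
Proof.
move=> C ab; have [T0 T0' EY EZ] := (closingE T T').1 C.
pose hL := half_time (- l1) (- l2) a1 a2; pose hR := half_time r1 r2 b1 b2.
pose f y := Zr (hR y) - Z (hL y).
pose g y := - tilt r1 r2 (hR y) - - tilt (- l1) (- l2) (hL y).
have nL : \forall y \near Y T, 0 < hL y /\ Y (hL y) = y := (der_half_time Hk T0).2.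
have nR : \forall y \near Y T, 0 < hR y /\ Yr (hR y) = y.
  by rewrite EY; exact: (der_half_time Hj T0').2.
have fE : \forall y \near Y T, f y = displacement S y.
  apply: filterS2 nL nR => y [h1 h2] [h3 h4].
  have EL := P_L_return h1; have ER := P_R_inv_return h3.
  by rewrite h2 in EL; rewrite h4 in ER; rewrite /displacement EL ER.
have hLT : hL (Y T) = T by apply: (half_timeK Hk T0).
have hRT : hR (Y T) = T' by rewrite EY; apply: (half_timeK Hj T0').
have f0 : f (Y T) = 0 by rewrite /f hLT hRT EZ subrr.
have fD : \forall y \near Y T, is_derive (y : R) 1 f (g y).
  have dL := near_der_return Hk T0; have := near_der_return Hj T0'.
  rewrite -/Yr -EY => dR; apply: filterS2 dL dR => y dL dR.
  exact: derD dR (derN dL).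
have gD : \forall y \near Y T, derivable g (y : R) 1.
  have dL := near_derivable_tilt Hk T0; have := near_derivable_tilt Hj T0'.
  rewrite -/Yr -EY => dR; apply: filterS2 dL dR => y dL dR.
  exact (derivableB (derivableN dR) (derivableN dL)).
have gR : is_derive (Y T) 1 (fun y => tilt r1 r2 (hR y))
    (contact (tilt r1 r2 T') (r1 * T') (r2 * T') / (Z T - Y T)).
  by rewrite EY EZ; apply: (der_return_tilt Hj T0').
have gN : is_derive (Y T) 1 g _ := derD (derN gR) (derN (derN (der_return_tilt Hk T0))).
apply: (zero_of_multiplicity_near fE).
case: eqP => [uE|/eqP uN].
- have dN := closing_contact_neq Hk Hj ab C uE.
  apply: (zero_of_multiplicity2 fD f0 _ gD gN).
  + by rewrite /g hLT hRT uE; ring.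
  + rewrite -mulNr opprK -mulrDl mulf_neq0 // ?invr_eq0.
      by rewrite addrC subr_eq0.
    have := gap_scale_gt0 Hk T0; rewrite -/Z -/Y.
    by apply: contraTneq => ->; rewrite mulr0 ltxx.
- apply: (@zero_of_multiplicity1 _ f (Y T) (g (Y T))).
  + by apply: filterS fD => y [].
  + exact: f0.
  + exact: (nbhs_singleton fD).
  + have -> : g (Y T) = tilt (- l1) (- l2) T - tilt r1 r2 T' by rewrite /g hLT hRT; ring.
    by rewrite subr_eq0.
Qed.

Let Y_cvg T : 0 < T -> Y x @[x --> T] --> Y T.
Proof. by move=> T0; apply: der_continuous (der_yent a1 a2 k12 k1k2 T0). Qed.

Let Z_cvg T : 0 < T -> Z x @[x --> T] --> Z T.
Proof. by move=> T0; apply: der_continuous (der_zret a1 a2 k12 k1k2 T0). Qed.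

Lemma unit_scale (f : R -> 'cV[R]_2) T (U : set 'cV[R]_2) : 0 <= T ->
  (f @` [set t | 0 <= t <= T] `<=` U) <-> (forall s : R, 0 <= s <= 1 -> U (f (s * T))).
Proof.
move=> T0; split=> H.
- move=> s /andP[s0 s1]; apply: H; exists (s * T) => //=.
  by rewrite mulr_ge0 //= ler_piMl.
- move=> _ [t /= /andP[t0 tT] <-]; have [T_0|TN] := eqVneq T 0.
    have -> : t = 0 * T by apply/eqP; rewrite mul0r eq_le t0 -{1}T_0 tT.
    by apply: H; rewrite lexx ler01.
  have -> : t = t / T * T by rewrite divfK.
  apply: H; rewrite divr_ge0 //= ler_pdivrMr ?mul1r //.
  by rewrite lt_def TN.
Qed.

Lemma orbit_near U T c : 0 < T -> 0 < c -> open U -> orbit T (c * T) `<=` U ->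
  \forall T1 \near T, orbit T1 (c * T1) `<=` U.
Proof.
move=> T0 c0 oU; rewrite /orbit subUset => -[].
move=> /(unit_scale _ _ (ltW T0)).1 UL /(unit_scale _ _ (mulr_ge0 (ltW c0) (ltW T0))).1 UR.
have NL := @flow_near R U Y l1 l2 p1 p2 a1 a2 T 1 oU (Y_cvg T0).
have NR := @flow_near R U Z r1 r2 q1 q2 b1 b2 T c oU (Z_cvg T0) UR.
have {}NL := NL (fun s h => eq_ind_r (fun w => U (flowL (Y T) (s * w))) (UL s h) (mul1r T)).
have N0 : \forall T1 \near T, 0 < T1 by exact: lt_nbhsr.
apply: filterS3 N0 NL NR => T1 T10 hL hR; rewrite subUset; split.
- by apply/unit_scale => [|s /hL]; [exact: ltW | rewrite mul1r].
- by apply/unit_scale => //; rewrite mulr_ge0 // ltW.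
Qed.

Lemma orbit_axis T T' y : closingS T T' -> orbit T T' (axis_pt y) -> y = Y T \/ y = Z T.
Proof.
move=> /closingE[T0 T0' EY EZ].
have [_ _ L0 LT Lx] : Defs.left_arc S (Y T) (Z T) T (flowL (Y T)) by apply/left_arc_param.
have [_ _ R0 RT Rx] : Defs.right_arc S (Z T) (Y T) T' (flowR (Z T)).
  by apply/right_arc_param; rewrite EY EZ.
have inj x x' : axis_pt x = axis_pt x' -> x = x'.
  by move=> h; rewrite -(axis_ptE x).2 h (axis_ptE x').2.
case=> -[t /= /andP[]]; rewrite !le_eqVlt => /predU1P[<- _|t0 /predU1P[->|tT]].
- by rewrite L0 => /inj; left.
- by rewrite LT => /inj; right.
- move=> E; have := Lx t; rewrite t0 tT E /left_plane /= /xcoord (axis_ptE y).1 ltxx.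
  by move=> /(_ isT).
- by rewrite R0 => /inj; right.
- by rewrite RT => /inj; left.
- move=> E; have := Rx t; rewrite t0 tT E /right_plane /= /xcoord (axis_ptE y).1 ltxx.
  by move=> /(_ isT).
Qed.

(** With common centres, one closing gives [r_i * T' = - l_i * T]: the rates are proportional, and
    every [T1] closes with [c * T1] where [c = T' / T]. By continuity, [U] contains such orbits with
    [T1 < T]. *)
Lemma centre_not_isolated Gamma : e * a1 = e * b1 -> e * a2 = e * b2 -> ~ limit_cycle S Gamma.
Proof.
move=> ab1 ab2 [[y /orbitP[T [T' [C yE ->]]]] [U [oU GU iso]]].
have [T0 T0' EY EZ] := (closingE T T').1 C; have TN := lt0r_neq0 T0.
have gap : 0 < e * (Z T - Y T) := gap_scale_gt0 Hk T0.
have rate k r x : Y T - x = expR (k * T) * (Z T - x) ->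
    Y T - x = expR (r * T') * (Z T - x) -> r * T' = k * T.
  move=> E1 E2; have ZN : Z T - x != 0.
    apply: contraTneq gap => z0; move: E1; rewrite z0 mulr0 => y0.
    have -> : Z T - Y T = (Z T - x) - (Y T - x) by ring.
    by rewrite z0 y0 subrr mulr0 ltxx.
  by move: E1; rewrite E2 => /(mulIf ZN)/expR_inj.
have aE1 : a1 = b1 by apply: (mulfI eN).
have aE2 : a2 = b2 by apply: (mulfI eN).
have r1E : r1 * T' = - l1 * T.
  apply: (rate _ _ a1); first exact: zret_rel1.
  by rewrite EY EZ aE1; apply: zret_rel1; rewrite ?lt0r_neq0.
have r2E : r2 * T' = - l2 * T.
  apply: (rate _ _ a2); first exact: zret_rel2.
  by rewrite EY EZ aE2; apply: zret_rel2; rewrite ?lt0r_neq0.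
pose c := T' / T; have c0 : 0 < c by rewrite divr_gt0.
have TE : T' = c * T by rewrite divfK.
have rc r k : r * T' = k * T -> r * c = k.
  by move=> h; apply: (mulIf TN); rewrite -h TE mulrA.
have closed T1 : 0 < T1 -> closingS T1 (c * T1).
  move=> T10; split; [by []|exact: mulr_gt0| |].
  - by rewrite -ab1 mulrA (rc _ _ r1E); apply: zret_rel1; rewrite ?lt0r_neq0.
  - by rewrite -ab2 mulrA (rc _ _ r2E); apply: zret_rel2; rewrite ?lt0r_neq0.
rewrite TE in GU iso.
have near_in : \forall T1 \near T^'-, [/\ T1 < T, 0 < T1 & orbit T1 (c * T1) `<=` U].
  have h1 := nbhs_left_lt T; have h2 := nbhs_left_gt T0.
  have h3 : \forall T1 \near T^'-, orbit T1 (c * T1) `<=` U.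
    by apply: cvg_within; exact: (orbit_near T0 c0 oU GU).
  by apply: filterS3 h1 h2 h3 => T1 *; split.
have [T1 [T1T T10 T1U]] := filter_ex near_in.
have per : crossing_periodic_orbit S (orbit T1 (c * T1)).
  by exists (Y T1); apply/orbitP; exists T1, (c * T1); split=> //; exact: closed.
have eqG := iso _ per T1U.
have T1in : orbit T (c * T) (axis_pt (Y T1)).
  rewrite -eqG; left; exists 0; first by rewrite /= lexx ltW.
  exact: (flow_start HL).
(* After multiplication by [e], [Y T1] lies strictly between [Y T] and [Z T], the only axis points
   of the first orbit. *)
have cY := yent_lt Hk T10 T1T; have cZ := zret_lt Hk T10 T1T; have cg := gap_gt0 Hk T10.
move: cY cZ cg; rewrite !yent_scale !zret_scale -/Y -/Z.
by have [->|->] := orbit_axis (closed T T0) T1in; lra.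
Qed.

Let noncentre Gamma : limit_cycle S Gamma -> ~ (e * a1 = e * b1 /\ e * a2 = e * b2).
Proof. by move=> lc [E1 E2]; exact: centre_not_isolated E1 E2 lc. Qed.

Lemma nodes_cycles_bound : cycles_bound S.
Proof.
have [[T [T' C]]|none] := pselect (exists T T', closingS T T'); last first.
  apply: (@cycles_boundP _ _ [::] (fun=> 0%N)) => [Gamma lc|Gamma lc|]; last by rewrite big_nil.
    by case: (lc) => -[y /orbitP[T [T' [C _ _]]]] _; case: none; exists T, T'.
  by case: (lc) => -[y /orbitP[T [T' [C _ _]]]] _; case: none; exists T, T'.
have orbit_of Gamma : limit_cycle S Gamma -> exists T1 T1', closingS T1 T1' /\ Gamma = orbit T1 T1'.
  by case=> -[y /orbitP[T1 [T1' [C1 _ GE]]]] _; exists T1, T1'.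
have mult_of T1 T1' : closingS T1 T1' -> ~ (e * a1 = e * b1 /\ e * a2 = e * b2) ->
    has_multiplicity S (orbit T1 T1') (if tilt (- l1) (- l2) T1 == tilt r1 r2 T1' then 2 else 1)%N.
  move=> C1 ab; exists (Y T1); split; last exact: displacement_multiplicity.
  by apply/orbitP; exists T1, T1'.
have [[T1 [T1' [C1 TN]]]|uniqueT] := pselect (exists T1 T1', closingS T1 T1' /\ T != T1).
(* Two intersections: neither is a tangency, so multiplicity 1 is correct for every limit cycle. *)
- apply: (@cycles_boundP _ _ [:: orbit T T'; orbit T1 T1'] (fun=> 1%N)) => [Gamma lc|Gamma lc|].
  + have ab := noncentre lc; have [T2 [T2' [C2 ->]]] := orbit_of _ lc.
    rewrite !inE; have [E|N] := eqVneq T2 T.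
      by rewrite E in C2 *; rewrite (closing_time_unique C2 C) eqxx.
    have [E|N1] := eqVneq T2 T1.
      by rewrite E in C2 *; rewrite (closing_time_unique C2 C1) eqxx orbT.
    exfalso; have le2 := closing_le2 Hk Hj ab.
    (* Six of the eight combinations order the three times, against [closing_le2]; the other two are
       cyclic. *)
    move: TN N N1; rewrite !neq_lt => /orP[h1|h1] /orP[h2|h2] /orP[h3|h3];
    first [by apply: (le2 _ _ _ _ _ _ C C1 C2) | by apply: (le2 _ _ _ _ _ _ C C2 C1)
      | by apply: (le2 _ _ _ _ _ _ C1 C C2) | by apply: (le2 _ _ _ _ _ _ C1 C2 C)
      | by apply: (le2 _ _ _ _ _ _ C2 C C1) | by apply: (le2 _ _ _ _ _ _ C2 C1 C) | by have := lt_trans (lt_trans h1 h3) h2; rewrite ltxx | by have := lt_trans (lt_trans h1 h2) h3; rewrite ltxx].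
  + have ab := noncentre lc; have [T2 [T2' [C2 ->]]] := orbit_of _ lc.
    have := mult_of _ _ C2 ab; case: eqP => // uE _; exfalso.
    have E := closing_tangent_unique Hk Hj ab C2 C uE.
    have E1 := closing_tangent_unique Hk Hj ab C2 C1 uE.
    by rewrite -E -E1 eqxx in TN.
  + by rewrite sum1_size (leq_trans (size_undup _)).
- pose m := (if tilt (- l1) (- l2) T == tilt r1 r2 T' then 2 else 1)%N.
  have only Gamma : limit_cycle S Gamma -> Gamma = orbit T T'.
    move=> /orbit_of[T1 [T1' [C1 ->]]]; have [E|N] := eqVneq T T1; last first.
      by case: uniqueT; exists T1, T1'.
    by rewrite -E in C1 *; rewrite (closing_time_unique C1 C).
  apply: (@cycles_boundP _ _ [:: orbit T T'] (fun=> m)) => [Gamma lc|Gamma lc|].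
  + by rewrite inE (only _ lc).
  + by rewrite (only _ lc); apply: (mult_of _ _ C (noncentre lc)).
  + by rewrite /= big_seq1 /m; case: ifP.
Qed.

End Orbits.

Lemma no_cycles_bound (R : realType) (S : pwl_system R) :
  (forall Gamma, ~ limit_cycle S Gamma) -> cycles_bound S.
Proof.
move=> none; apply: (@cycles_boundP _ _ [::] (fun=> 0%N)) => [Gamma /none|Gamma /none|] //.
by rewrite big_nil.
Qed.

Theorem theorem1p1 (R : realType) (S : pwl_system R) (hNN : NN_type S) :
  exists (cycles : seq (set 'cV[R]_2)) (mult : set 'cV[R]_2 -> nat),
    [/\ uniq cycles,
        forall Gamma : set 'cV[R]_2, Gamma \in cycles <-> limit_cycle S Gamma,
        forall Gamma : set 'cV[R]_2,
          limit_cycle S Gamma -> has_multiplicity S Gamma (mult Gamma) &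
        (\sum_(Gamma <- cycles) mult Gamma <= 2)%N].
Proof.
rewrite -/(cycles_bound S); case: hNN => nodeL nodeR.
have [AL0|ALN] := eqVneq (AL S 0 1) 0.
  apply: no_cycles_bound => Gamma [[y [z [T [T' [phi [psi [arcL _ _ _ _]]]]]]] _].
  by apply: (no_arc AL0 _ arcL) => p /= h; rewrite lt_eqF.
have [AR0|ARN] := eqVneq (AR S 0 1) 0.
  apply: no_cycles_bound => Gamma [[y [z [T [T' [phi [psi [_ arcR _ _ _]]]]]]] _].
  by apply: (no_arc AR0 _ arcR) => p /= h; rewrite gt_eqF.
have [l1 [l2 [p1 [p2 [a1 [a2 [HL ll]]]]]]] := node_coords_exist (bL S) nodeL ALN.
have [r1 [r2 [q1 [q2 [b1 [b2 [HR rr]]]]]]] := node_coords_exist (bR S) nodeR ARN.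
(* A single crossing orbit provides the orientation of both nodes and the common sign of [AL S 0 1]
   and [AR S 0 1]; without any, the bound is trivial. *)
have [[Gamma [y [z [T [T' [phi [psi [arcL arcR _ _ _]]]]]]]]|none] :=
  pselect (exists Gamma, crossing_periodic_orbit S Gamma); last first.
  by apply: no_cycles_bound => Gamma [per _]; apply: none; exists Gamma.
have [T0 E1 E2 eL _] := (left_arcP HL y z T phi).1 arcL.
have [T0' F1 F2 eR _] := (right_arcP HR z y T' psi).1 arcR.
have rev l t (u v c : R) : v - c = expR (l * t) * (u - c) -> u - c = expR (- l * t) * (v - c).
  by move=> ->; rewrite mulrA mulNr -expRD addNr expR0 mul1r.
have l12 : 0 < - l1 * - l2 by rewrite mulrNN; case: HL.
have r12 : 0 < r1 * r2 by case: HR.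
have kk : (- l2) ^+ 2 < (- l1) ^+ 2 by rewrite !sqrrN.
apply: (nodes_cycles_bound HL HR).
- exact: (node_data_of_pair l12 kk T0 (rev _ _ _ _ _ E1) (rev _ _ _ _ _ E2) eL).
- exact: (node_data_of_pair r12 rr T0' F1 F2 eL).
- have zy : 0 < (z - y) ^+ 2.
    by rewrite exprn_even_gt0 //=; apply: contraTneq eL => ->; rewrite mulr0 ltxx.
  rewrite -(pmulr_lgt0 _ zy).
  have -> : AL S 0 1 * AR S 0 1 * (z - y) ^+ 2 = AL S 0 1 * (z - y) * - (AR S 0 1 * (y - z)) by ring.
  by rewrite mulr_gt0 // oppr_gt0.
Qed.
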